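(* Let $p$ be a prime and let $G$ be a finite $p$-group that is extraspecial or almost extraspecial, and let $r$ be the rank of $G$. Then $G$ acts freely and smoothly on a product of $r$ spheres.
   Context: The rank of a finite group is the maximum $k$ such that it contains a subgroup isomorphic to $(\mathbb{Z}/q)^k$ for some prime $q$. A finite $p$-group $G$ is extraspecial if its center $Z(G)$, its commutator subgroup $[G,G]$ and its Frattini subgroup $\Phi(G)$ coincide and have order $p$; it is almost extraspecial if $[G,G]=\Phi(G)$ has order $p$ and $Z(G)$ is cyclic of order $p^2$. Spheres carry their standard smooth structure and products carry the product smooth structure. *)

(* Defs.v *)
From HB Require Import structures.
From mathcomp Require Import all_boot all_order all_algebra all_fingroup all_solvable.
From mathcomp Require Import all_classical all_reals all_analysis.
Import numFieldNormedType.Exports.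

Set Implicit Arguments.
Unset Strict Implicit.
Unset Printing Implicit Defensive.

Import Order.TTheory GRing.Theory Num.Theory.
Local Open Scope classical_set_scope.
Local Open Scope ring_scope.

Definition almost_extraspecial (p : nat) (gT : finGroupType) (G : {set gT}) :=
  [/\ G^`(1)%g = 'Phi(G)%g, #|G^`(1)%g| = p,
      cyclic 'Z(G)%g & #|'Z(G)%g| = (p ^ 2)%N].

(** [iter_partial [:: i1; ...; ik] F] is the iterated partial derivative
    d/dx_i1 ... d/dx_ik F; like ['D_v], it is only meaningful where the
    derivatives involved exist. *)
Definition iter_partial (R : realType) (m k : nat) (s : seq 'I_m)
    (F : 'rV[R]_m -> 'rV[R]_k) : 'rV[R]_m -> 'rV[R]_k :=
  foldr (fun i (g : 'rV[R]_m -> 'rV[R]_k) => 'D_(delta_mx 0 i) g) F s.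

(** C^oo on an open set [U]: iterated partial derivatives of every order exist
    and are continuous at every point of [U]. *)
Definition smooth_on (R : realType) (m k : nat) (U : set 'rV[R]_m)
    (F : 'rV[R]_m -> 'rV[R]_k) : Prop :=
  forall (s : seq 'I_m) (x : 'rV[R]_m), U x ->
    {for x, continuous (iter_partial s F)} /\
    forall i : 'I_m, derivable (iter_partial s F) x (delta_mx 0 i).

(** Smoothness of a map between subsets of Euclidean spaces: locally it extends
    to a C^oo map of the ambient spaces. For embedded submanifolds this is
    smoothness for the induced smooth structures. *)
Definition smooth_map (R : realType) (m k : nat)
    (A : set 'rV[R]_m) (B : set 'rV[R]_k) (f : A -> B) : Prop :=
  forall x : A, exists (U : set 'rV[R]_m) (F : 'rV[R]_m -> 'rV[R]_k),
    [/\ open U, U (set_val x), smooth_on U F &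
        forall y : A, U (set_val y) -> set_val (f y) = F (set_val y)].

(** The sphere S^d in R^(d+1). The library norm on row vectors is the sup norm,
    so the Euclidean norm is written out. *)
Definition unit_sphere (R : realType) (d : nat) : set 'rV[R]_d.+1 :=
  [set v : 'rV[R]_d.+1 | \sum_(j < d.+1) v 0 j ^+ 2 = 1].
Arguments unit_sphere : clear implicits.

(** S^(n_0) x ... x S^(n_(r-1)), inside the direct sum of the R^(n_i + 1): a
    vector of that sum is the concatenation of its blocks [submxrow x i]. The
    product smooth structure is the one induced by this embedding. *)
Definition product_of_spheres (R : realType) (r : nat) (n : 'I_r -> nat) :
    set 'rV[R]_(\sum_(i < r) (n i).+1) :=
  [set x | forall i : 'I_r, unit_sphere R (n i) (submxrow x i)].
Arguments product_of_spheres R {r} n _.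

Definition free_action (gT : finGroupType) (G : {set gT}) (X : Type)
    (to : action G X) : Prop :=
  forall (x : X) (a : gT), a \in G -> to x a = x -> a = 1%g.

Definition smooth_action (gT : finGroupType) (G : {set gT}) (R : realType)
    (m : nat) (A : set 'rV[R]_m) (to : action G A) : Prop :=
  forall a : gT, a \in G -> smooth_map (fun x : A => to x a).

(* Main.v *)
Require Import Defs.
From HB Require Import structures.
From mathcomp Require Import all_boot all_order all_algebra all_fingroup all_solvable.
From mathcomp Require Import all_classical all_reals all_analysis.
From mathcomp Require Import ring zify.
Import numFieldNormedType.Exports.

(** Put Z = G' = Phi(G), a normal subgroup of order p. The real functions on G
    whose sums over all cosets of Z vanish form a representation in which Z
    fixes no nonzero vector, so the isotropy groups on its sphere meet Z
    trivially; hence they are elementary abelian of order at most p^(r-1).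

    Each further sphere divides the maximal isotropy order kappa by p. Over a
    G-manifold M, suppose that a trivial bundle of rank c |G| / kappa, with
    trivial action on the fibre, embeds equivariantly into c copies of the
    regular representation R[G]. At a point whose isotropy group K has order
    kappa the image is exactly the space of K-invariants, so K fixes no nonzero
    vector of the cokernel E. Some multiple of E is trivial once the action is
    forgotten, so that its sphere bundle is a product M x S^d on which G acts.

    An embedding exists locally by a Vandermonde determinant. On the maximal
    stratum, two embeddings a : T -> B and b : T -> B, invertible on different
    open sets, are glued as follows: the Koszul matrix of (a, b) gives an
    isomorphism T T + B B = T B + B T, one has B B = T B, and what has to be
    cancelled is a retract of a multiple of T. Off that stratum the target has
    at least twice the rank of the source, and this leaves room to deform one
    embedding into another. All maps involved are matrices of functions
    built from coordinates by ring operations, inverses, square roots and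
    exp(-1/t). *)

Set Implicit Arguments.
Unset Strict Implicit.
Unset Printing Implicit Defensive.

Import Order.TTheory GRing.Theory Num.Theory.
Local Open Scope ring_scope.

(** * Matrices indexed by finite types *)

(** On the maximal stratum the embedding has a target of exactly the same rank, so general position
    is of no help and local isomorphisms have to be glued after passing to multiples. In K-theoretic
    terms, let B be the bundle over the orbit space whose fibre is the space of functions on the
    orbit. Invertibility of a and of b kills multiples of T - B over two open sets, so a multiple of
    (T - B)^2 vanishes over their union; the Koszul matrix is the explicit isomorphism behind this.
    Pulled back to the manifold B becomes trivial, and pushing forward again gives B B = T B.
    Together these give T T = T B stably, and enlarging c absorbs both the factor T and the
    cancellation. Equivariance costs nothing: an equivariant map into copies of R[H] is determined
    by its component at 1, which may be an arbitrary function on the manifold. The room off the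
    maximal stratum comes from H being a p-group: a smaller isotropy group has order at most kappa /
    p, so its space of invariants is at least p times larger. *)

Section FinMatrices.
Variable R : realFieldType.

Definition inj_mx (J I : finType) (F : J -> I -> R) : Prop :=
  forall v : I -> R, (forall j, \sum_i F j i * v i = 0) -> forall i, v i = 0.

Definition to_mx (J I : finType) (F : J -> I -> R) : 'M[R]_(#|J|, #|I|) :=
  \matrix_(j, i) F (enum_val j) (enum_val i).

Lemma sum_enum_val (I : finType) (f : I -> R) :
  \sum_i f i = \sum_(k < #|I|) f (enum_val k).
Proof.
by rewrite (reindex (enum_val : 'I_#|I| -> I)) //; exists enum_rank => k _; rewrite ?enum_valK ?enum_rankK.
Qed.

Lemma to_mx_mulE (J I : finType) (F : J -> I -> R) (v : 'cV[R]_#|I|) j :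
  (to_mx F *m v) j 0 = \sum_i F (enum_val j) i * v (enum_rank i) 0.
Proof.
by rewrite mxE [RHS]sum_enum_val; apply: eq_bigr => i _; rewrite mxE enum_valK.
Qed.

Lemma inj_mxP (J I : finType) (F : J -> I -> R) :
  inj_mx F <-> forall v : 'cV[R]_#|I|, to_mx F *m v = 0 -> v = 0.
Proof.
split=> [injF v Fv0|H v Fv0 i].
  apply/matrixP => k l; rewrite ord1 mxE.
  have := injF (fun i => v (enum_rank i) 0) _ (enum_val k).
  rewrite enum_valK; apply=> j.
  by rewrite -(enum_rankK j) -to_mx_mulE Fv0 mxE.
have /matrixP/(_ (enum_rank i) 0) :
    \col_k v (enum_val k) = 0 :> 'cV[R]_#|I|.
  apply: H; apply/matrixP => k l; rewrite ord1 to_mx_mulE mxE.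
  by rewrite -[RHS](Fv0 (enum_val k)); apply: eq_bigr => i' _; rewrite mxE enum_rankK.
by rewrite !mxE enum_rankK.
Qed.

Lemma inj_mx_rank (J I : finType) (F : J -> I -> R) :
  inj_mx F -> \rank (to_mx F) = #|I|.
Proof.
move=> /inj_mxP injF; rewrite -mxrank_tr.
apply/eqP/inj_row_free => v /(congr1 trmx).
rewrite trmx_mul trmxK trmx0 => /injF/(congr1 trmx).
by rewrite trmxK trmx0.
Qed.

Lemma inj_mx_card (J I : finType) (F : J -> I -> R) : inj_mx F -> (#|I| <= #|J|)%N.
Proof. by move=> /inj_mx_rank <-; exact: rank_leq_row. Qed.

Lemma inj_mx_surj (J I : finType) (F : J -> I -> R) : #|I| = #|J| -> inj_mx F ->
  forall w : J -> R, exists v : I -> R, forall j, \sum_i F j i * v i = w j.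
Proof.
move=> IJ injF w.
have full : row_full (to_mx F)^T.
  by rewrite /row_full mxrank_tr (inj_mx_rank injF) IJ.
have /submxP [D wD] : (\row_k w (enum_val k) <= (to_mx F)^T)%MS by exact: submx_full.
exists (fun i => D 0 (enum_rank i)) => j.
move/(congr1 trmx): wD; rewrite trmx_mul trmxK => /matrixP/(_ (enum_rank j) 0).
rewrite to_mx_mulE !mxE enum_rankK => ->.
by apply: eq_bigr => i _; rewrite mxE.
Qed.

Definition gram (J I : finType) (F : J -> I -> R) : 'M[R]_#|I| :=
  \matrix_(i, i') \sum_j F j (enum_val i) * F j (enum_val i').

(** The square makes [gramdet] nonnegative, and the extra factor in [graminv]
    makes [graminv] vanish wherever [gramdet] does. *)
Definition gramdet (J I : finType) (F : J -> I -> R) : R := \det (gram F) ^+ 2.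

Definition graminv (J I : finType) (F : J -> I -> R) (i : I) (j : J) : R :=
  \det (gram F) *
    \sum_i' (\adj (gram F)) (enum_rank i) (enum_rank i') * F j i'.

Lemma gram_inj (J I : finType) (F : J -> I -> R) :
  inj_mx F <-> \det (gram F) != 0.
Proof.
have gramE (v : I -> R) i : \sum_j F j i * (\sum_i' F j i' * v i') =
    (gram F *m \col_k v (enum_val k)) (enum_rank i) 0.
  rewrite mxE.
  under eq_bigr => j _ do rewrite sum_enum_val big_distrr.
  rewrite exchange_big; apply: eq_bigr => i' _ /=.
  rewrite !mxE !enum_rankK big_distrl /=; apply: eq_bigr => j _.
  by rewrite mulrA.
split=> [injF|nz v Fv i]; last first.
  have /matrixP/(_ (enum_rank i) 0) : \col_k v (enum_val k) = 0 :> 'cV[R]_#|I|.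
    apply: (@can_inj _ _ (mulmx (gram F)) (mulmx (invmx (gram F)))) => [w|].
      by rewrite mulKmx // unitmxE unitfE.
    rewrite mulmx0; apply/matrixP => k l; rewrite ord1 -(enum_valK k) -gramE mxE.
    by rewrite big1 // => j _; rewrite Fv mulr0.
  by rewrite !mxE enum_rankK.
apply/negP => /eqP det0.
have /det0P [w wn0] : \det (gram F)^T == 0 by rewrite det_tr det0.
move=> /(congr1 trmx); rewrite trmx_mul trmxK trmx0 => wG.
case/negP: wn0; apply/eqP/matrixP => k l; rewrite (ord1 k) [RHS]mxE.
pose v i := w 0 (enum_rank i).
have vE : \col_k v (enum_val k) = w^T.
  by apply/matrixP => a b; rewrite !mxE ord1 /v enum_valK.
have := injF v _ (enum_val l); rewrite {2}/v enum_valK; apply=> j.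
(* This is |F v|^2 = v^T (gram F) v, so a kernel vector of the Gram matrix is one of [F]. *)
have : \sum_j (\sum_i F j i * v i) ^+ 2 = 0.
  transitivity (\sum_i v i * \sum_j F j i * (\sum_i' F j i' * v i')).
    under [RHS]eq_bigr => i _ do rewrite big_distrr /=.
    rewrite exchange_big; apply: eq_bigr => j' _ /=.
    rewrite expr2 {1}big_distrl /=; apply: eq_bigr => i _.
    by rewrite mulrA [v i * _]mulrC.
  by rewrite big1 // => i _; rewrite gramE vE wG mxE mulr0.
move/eqP; rewrite psumr_eq0 => [/allP/(_ j)|j' _]; last exact: sqr_ge0.
by rewrite mem_index_enum sqrf_eq0 => /(_ isT)/eqP.
Qed.

Lemma gramdet_ge0 (J I : finType) (F : J -> I -> R) : 0 <= gramdet F.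
Proof. exact: sqr_ge0. Qed.

Lemma gramdet_gt0 (J I : finType) (F : J -> I -> R) : inj_mx F <-> 0 < gramdet F.
Proof. by rewrite gram_inj /gramdet lt_def sqr_ge0 andbT sqrf_eq0. Qed.

Lemma graminv_mul (J I : finType) (F : J -> I -> R) i i' :
  \sum_j graminv F i j * F j i' = gramdet F * (i == i')%:R.
Proof.
transitivity (\det (gram F) * (\adj (gram F) *m gram F) (enum_rank i) (enum_rank i')); last first.
  rewrite mul_adj_mx !mxE (inj_eq enum_rank_inj) /gramdet expr2 -mulrA.
  by case: eqP => _; rewrite ?mulr1 // mulr0n !mulr0.
rewrite mxE big_distrr /=.
under [RHS]eq_bigr => k _ do rewrite [gram F _ _]mxE !big_distrr /=.
rewrite exchange_big; apply: eq_bigr => j _ /=.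
rewrite /graminv -mulrA -big_distrr /=; congr (_ * _).
rewrite [in LHS]sum_enum_val big_distrl /=; apply: eq_bigr => k _.
by rewrite enum_valK enum_rankK mulrA.
Qed.

Lemma graminv_eq0 (J I : finType) (F : J -> I -> R) i j : gramdet F = 0 -> graminv F i j = 0.
Proof. by move=> /eqP; rewrite sqrf_eq0 /graminv => /eqP ->; rewrite mul0r. Qed.

(** With [s] a left translation of the group, this and the next two lemmas make Gram determinants
    constant along orbits and left inverses equivariant. *)
Lemma gram_reindex (J I : finType) (F G : J -> I -> R) (s : J -> J) :
  injective s -> (forall j i, G j i = F (s j) i) -> gram G = gram F.
Proof.
move=> injs GF; apply/matrixP => i i'; rewrite !mxE [RHS](reindex_inj injs) /=.
by apply: eq_bigr => j _; rewrite !GF.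
Qed.

Lemma gramdet_reindex (J I : finType) (F G : J -> I -> R) (s : J -> J) :
  injective s -> (forall j i, G j i = F (s j) i) -> gramdet G = gramdet F.
Proof. by move=> injs GF; rewrite /gramdet (gram_reindex injs GF). Qed.

Lemma graminv_reindex (J I : finType) (F G : J -> I -> R) (s : J -> J) :
  injective s -> (forall j i, G j i = F (s j) i) ->
  forall i j, graminv G i j = graminv F i (s j).
Proof.
move=> injs GF i j; rewrite /graminv (gram_reindex injs GF); congr (_ * _).
by apply: eq_bigr => i' _; rewrite GF.
Qed.

End FinMatrices.

(** * Smooth functions and smooth actions *)

(** [flat 0] is zero on t <= 0 and positive on t > 0; the other [flat k] occur in
    its derivatives. *)
Definition flat (R : realType) (k : nat) (t : R) : R :=
  if 0 < t then t^-1 ^+ k * expR (- t^-1) else 0.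

(** Stands for a manifold with its Euclidean coordinates. Joint injectivity of the coordinates lets
    smooth functions detect isotropy and separate the points of an orbit. *)
Record space (R : realType) := Space {
  pt : Type;
  idx : finType;
  crd : idx -> pt -> R;
  crd_inj : forall x y, (forall i, crd i x = crd i y) -> x = y }.

Arguments Space {R} pt idx crd crd_inj.

(** The functions on a space that are explicit expressions in its coordinates;
    all operations are defined on the whole space. *)
Inductive smooth_fun (R : realType) (X : space R) : (pt X -> R) -> Prop :=
| smooth_fun_cst c : smooth_fun (fun=> c)
| smooth_fun_crd i : smooth_fun (@crd R X i)
| smooth_fun_add f g : smooth_fun f -> smooth_fun g -> smooth_fun (fun x => f x + g x)
| smooth_fun_mul f g : smooth_fun f -> smooth_fun g -> smooth_fun (fun x => f x * g x)
| smooth_fun_inv f : smooth_fun f -> (forall x, f x != 0) -> smooth_fun (fun x => (f x)^-1)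
| smooth_fun_sqrt f : smooth_fun f -> (forall x, 0 < f x) -> smooth_fun (fun x => Num.sqrt (f x))
| smooth_fun_flat f : smooth_fun f -> smooth_fun (fun x => flat 0 (f x)).

Arguments smooth_fun_cst {R X} c.
Arguments smooth_fun_crd {R X} i.

Section SmoothFunctions.
Variables (R : realType) (X : space R).
Implicit Types f g : pt X -> R.

Lemma eq_smooth_fun f g : f =1 g -> smooth_fun f -> smooth_fun g.
Proof. by move=> /funext ->. Qed.

Lemma smooth_fun_opp f : smooth_fun f -> smooth_fun (fun x => - f x).
Proof.
move=> sf; rewrite (_ : (fun x => _) = fun x => (-1) * f x).
  by apply: smooth_fun_mul => //; exact: smooth_fun_cst.
by apply/funext => x; rewrite mulN1r.
Qed.

Lemma smooth_fun_sub f g : smooth_fun f -> smooth_fun g -> smooth_fun (fun x => f x - g x).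
Proof. by move=> sf sg; apply: smooth_fun_add => //; exact: smooth_fun_opp. Qed.

Lemma smooth_fun_sum (I : Type) (r : seq I) (P : pred I) (F : I -> pt X -> R) :
  (forall i, smooth_fun (F i)) -> smooth_fun (fun x => \sum_(i <- r | P i) F i x).
Proof.
move=> sF; elim: r => [|i r IH].
  by under eq_fun => x do rewrite big_nil; exact: smooth_fun_cst.
under eq_fun => x do rewrite big_cons.
by case: (P i) => //; exact: smooth_fun_add.
Qed.

Lemma smooth_fun_prod (I : Type) (r : seq I) (P : pred I) (F : I -> pt X -> R) :
  (forall i, smooth_fun (F i)) -> smooth_fun (fun x => \prod_(i <- r | P i) F i x).
Proof.
move=> sF; elim: r => [|i r IH].
  by under eq_fun => x do rewrite big_nil; exact: smooth_fun_cst.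
under eq_fun => x do rewrite big_cons.
by case: (P i) => //; exact: smooth_fun_mul.
Qed.

Lemma smooth_fun_exp f n : smooth_fun f -> smooth_fun (fun x => f x ^+ n).
Proof.
move=> sf; elim: n => [|n IH]; first by under eq_fun => x do rewrite expr0; exact: smooth_fun_cst.
by under eq_fun => x do rewrite exprS; exact: smooth_fun_mul.
Qed.

Lemma smooth_fun_div f g : smooth_fun f -> smooth_fun g -> (forall x, g x != 0) -> smooth_fun (fun x => f x / g x).
Proof. by move=> sf sg g0; apply: smooth_fun_mul => //; exact: smooth_fun_inv. Qed.

Lemma smooth_fun_det n (M : pt X -> 'M[R]_n) :
  (forall i j, smooth_fun (fun x => M x i j)) -> smooth_fun (fun x => \det (M x)).
Proof.
move=> sM; apply: smooth_fun_sum => s; apply: smooth_fun_mul; first exact: smooth_fun_cst.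
exact: smooth_fun_prod.
Qed.

Lemma smooth_fun_adj n (M : pt X -> 'M[R]_n) :
  (forall i j, smooth_fun (fun x => M x i j)) -> forall i j, smooth_fun (fun x => (\adj (M x)) i j).
Proof.
move=> sM i j; under eq_fun => x do rewrite mxE.
apply: smooth_fun_mul; first exact: smooth_fun_cst.
apply: smooth_fun_det => k l.
by under eq_fun => x do rewrite !mxE; exact: sM.
Qed.

Variables (J I : finType) (F : pt X -> J -> I -> R).
Hypothesis sF : forall j i, smooth_fun (fun x => F x j i).

Lemma smooth_fun_gram i i' : smooth_fun (fun x => gram (F x) i i').
Proof.
under eq_fun => x do rewrite mxE.
by apply: smooth_fun_sum => j; exact: smooth_fun_mul.
Qed.

Lemma smooth_fun_gramdet : smooth_fun (fun x => gramdet (F x)).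
Proof. by apply: smooth_fun_exp; apply: smooth_fun_det; exact: smooth_fun_gram. Qed.

Lemma smooth_fun_graminv i j : smooth_fun (fun x => graminv (F x) i j).
Proof.
apply: smooth_fun_mul; first by apply: smooth_fun_det; exact: smooth_fun_gram.
apply: smooth_fun_sum => k; apply: smooth_fun_mul => //.
by apply: smooth_fun_adj; exact: smooth_fun_gram.
Qed.

End SmoothFunctions.

Lemma smooth_fun_comp (R : realType) (X Y : space R) (h : pt X -> pt Y) :
  (forall i, smooth_fun (fun x => crd i (h x))) ->
  forall f, smooth_fun f -> smooth_fun (fun x => f (h x)).
Proof.
move=> sh f; elim=> {f}.
- by move=> c; exact: smooth_fun_cst.
- exact: sh.
- by move=> f g _ sf _ sg; exact: smooth_fun_add.
- by move=> f g _ sf _ sg; exact: smooth_fun_mul.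
- by move=> f _ sf f0; exact: smooth_fun_inv.
- by move=> f _ sf f0; exact: smooth_fun_sqrt.
- by move=> f _ sf; exact: smooth_fun_flat.
Qed.

Ltac smooth_fun_step :=
  match goal with
  | |- smooth_fun (fun x => - _) => apply: smooth_fun_opp
  | |- smooth_fun (fun x => _ + _) => apply: smooth_fun_add
  | |- smooth_fun (fun x => _ * _) => apply: smooth_fun_mul
  | |- smooth_fun (fun x => _ ^+ _) => apply: smooth_fun_exp
  | |- smooth_fun (fun x => \sum_(i <- _ | _) _) => apply: smooth_fun_sum => ?
  | |- smooth_fun (fun x => \prod_(i <- _ | _) _) => apply: smooth_fun_prod => ?
  | |- smooth_fun (fun x => flat 0 _) => apply: smooth_fun_flat
  | |- smooth_fun (fun=> ?c) => exact: smooth_fun_cst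
  | |- _ => solve [auto]
  end.
Ltac smooth := repeat smooth_fun_step.

Record smooth_act (R : realType) (X : space R) (H : finGroupType) := SmoothAct {
  sact :> pt X -> H -> pt X;
  sact1 : forall x, sact x 1%g = x;
  sactM : forall x g h, sact x (g * h)%g = sact (sact x g) h;
  smooth_fun_sact : forall h i, smooth_fun (fun x => crd i (sact x h)) }.

Section Stack.
Variables (R : realType) (X : space R) (H : finGroupType) (act : smooth_act X H).

Definition stab (x : pt X) : {set H} := [set h | `[< act x h = x >]].

Lemma stabP x h : reflect (act x h = x) (h \in stab x).
Proof. by rewrite inE; exact: asboolP. Qed.

Lemma stab_group_set x : group_set (stab x).
Proof.
apply/group_setP; split=> [|g h /stabP gx /stabP hx]; first by apply/stabP; exact: sact1.
by apply/stabP; rewrite sactM gx.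
Qed.
Definition stabG x : {group H} := Group (stab_group_set x).

Lemma sactV x g : act (act x g) g^-1%g = x.
Proof. by rewrite -sactM mulgV sact1. Qed.

Lemma sact_rcoset x g h :
  (h \in stab x :* g)%g -> act x h = act x g.
Proof. by case/rcosetP => s /stabP sx ->; rewrite sactM sx. Qed.

Lemma sact_eq x g h : act x g = act x h -> (g * h^-1)%g \in stab x.
Proof. by move=> e; apply/stabP; rewrite sactM e sactV. Qed.

Lemma smooth_fun_act f h : smooth_fun f -> smooth_fun (fun x => f (act x h)).
Proof. by move=> sf; apply: (smooth_fun_comp _ sf) => i; exact: smooth_fun_sact. Qed.

Variables (C D : finType) (phi : pt X -> C -> D -> R).

(** Read along the orbit of x, [phi] is an equivariant map from the trivial
    representation on D to C copies of the regular representation of H. *)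
Definition stack (x : pt X) (rg : C * H) (d : D) : R := phi (act x rg.2) rg.1 d.
Definition stack_inj (x : pt X) : Prop := inj_mx (stack x).
Definition stack_det (x : pt X) : R := gramdet (stack x).
(** Keeping the entries at 1 suffices: by equivariance the entries at g are the values at [act x g].
    This inverts [stack] only up to the factor [stack_det], which keeps it smooth everywhere. *)
Definition stack_inv (x : pt X) (d : D) (r : C) : R := graminv (stack x) d (r, 1%g).

Let shift (h : H) (rg : C * H) : C * H := (rg.1, (h * rg.2)%g).
Let shift_inj h : injective (shift h).
Proof. by move=> [r g] [r' g'] [-> /mulgI ->]. Qed.
Let stk_act x h rg d : stack (act x h) rg d = stack x (shift h rg) d.
Proof. by rewrite /stack sactM. Qed.

Lemma stack_injP x : stack_inj x <-> forall v : D -> R,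
  (forall g r, \sum_d phi (act x g) r d * v d = 0) -> forall d, v d = 0.
Proof.
split=> inj v Hv; first by apply: inj => -[r g]; exact: Hv.
by apply: inj => g r; exact: (Hv (r, g)).
Qed.

Lemma stack_det_act x h : stack_det (act x h) = stack_det x.
Proof. exact: (gramdet_reindex (@shift_inj h) (stk_act x h)). Qed.

Lemma stack_det_ge0 x : 0 <= stack_det x. Proof. exact: gramdet_ge0. Qed.
Lemma stack_det_gt0 x : stack_inj x <-> 0 < stack_det x. Proof. exact: gramdet_gt0. Qed.

Lemma stack_inv_act x g d r : stack_inv (act x g) d r = graminv (stack x) d (r, g).
Proof.
by rewrite /stack_inv (graminv_reindex (@shift_inj g) (stk_act x g)) /shift /= mulg1.
Qed.

Lemma stack_invK x d d' :
  \sum_g \sum_r stack_inv (act x g) d r * phi (act x g) r d' = stack_det x * (d == d')%:R.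
Proof.
rewrite -graminv_mul exchange_big pair_bigA /=; apply: eq_bigr => -[r g] _ /=.
by rewrite stack_inv_act.
Qed.

Definition orbit_fun (x : pt X) (u : H -> C -> R) : Prop :=
  forall g g', act x g = act x g' -> forall r, u g r = u g' r.

(** One row per coset of the stabilizer carries all the information of [stack x]. By the cardinality
    hypothesis the resulting matrix is square, so injectivity gives surjectivity. *)
Lemma stack_surj x (u : H -> C -> R) : (#|D| * #|stab x| = #|C| * #|H|)%N ->
  stack_inj x -> orbit_fun x u ->
  exists v : D -> R, forall g r, \sum_d phi (act x g) r d * v d = u g r.
Proof.
move=> cardD vx ou.
pose T : finType := {A : {set H} | A \in rcosets (stabG x) [set: H]}.
pose F (ra : C * T) d := phi (act x (repr (val ra.2))) ra.1 d.
have cardT : #|T| = #|[set: H] : stabG x|%g by rewrite card_sig.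
have DT : #|D| = #|{: C * T}|.
  rewrite card_prod cardT; apply/eqP.
  have s0 : (0 < #|stab x|)%N by exact: (cardG_gt0 (stabG x)).
  rewrite -(eqn_pmul2r s0) cardD -mulnA; apply/eqP; congr (_ * _)%N.
  have -> : #|H| = #|[set: H]%G| by rewrite cardsT.
  rewrite mulnC (@Lagrange _ [set: H]%G (stabG x)) //.
  by apply/fintype.subsetP => h; rewrite !inE.
have repr_act (a : T) g : g \in val a -> act x (repr (val a)) = act x g.
  case: a => /= _ /rcosetsP [h _ ->] gh.
  by rewrite (sact_rcoset gh); apply: sact_rcoset; exact: mem_repr gh.
have cosetT g : (stabG x :* g)%g \in rcosets (stabG x) [set: H].
  by apply/rcosetsP; exists g; rewrite ?inE.
pose cos g : T := exist _ (stabG x :* g)%g (cosetT g).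
have cos_act g : act x (repr (val (cos g))) = act x g.
  by apply: repr_act; exact: (rcoset_refl (stabG x)).
have injF : inj_mx F.
  move=> v Fv; apply: (proj1 (stack_injP x) vx) => g r.
  rewrite -[RHS](Fv (r, cos g)).
  by apply: eq_bigr => d _; rewrite /F cos_act.
have [v vE] := inj_mx_surj DT injF (fun ra => u (repr (val ra.2)) ra.1).
exists v => g r.
by have := vE (r, cos g); rewrite /F cos_act (ou _ _ (cos_act g)).
Qed.

(** [stack_inv] is only a left inverse; on the maximal stratum it is also a right
    inverse on functions of the orbit, by the dimension count in [cardD]. *)
Lemma stack_invKV x (u : H -> C -> R) : (#|D| * #|stab x| = #|C| * #|H|)%N ->
  orbit_fun x u -> forall g r,
  \sum_d phi (act x g) r d * (\sum_g' \sum_r' stack_inv (act x g') d r' * u g' r') =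
    stack_det x * u g r.
Proof.
move=> cardD ou g r; have [s0|s0] := eqVneq (stack_det x) 0.
  rewrite s0 mul0r big1 // => d _; rewrite big1 ?mulr0 // => g' _.
  by rewrite big1 // => r' _; rewrite stack_inv_act graminv_eq0 // mul0r.
have vx : stack_inj x by apply/stack_det_gt0; rewrite lt_def s0 stack_det_ge0.
have [v vE] := stack_surj cardD vx ou.
have vE2 d : \sum_g' \sum_r' stack_inv (act x g') d r' * u g' r' = stack_det x * v d.
  transitivity (\sum_d' (\sum_g' \sum_r' stack_inv (act x g') d r' * phi (act x g') r' d') * v d').
    under [RHS]eq_bigr => d' _ do rewrite big_distrl /=.
    rewrite [RHS]exchange_big; apply: eq_bigr => g' _ /=.
    under [RHS]eq_bigr => d' _ do rewrite big_distrl /=.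
    rewrite [RHS]exchange_big; apply: eq_bigr => r' _ /=.
    by rewrite -vE big_distrr /=; apply: eq_bigr => d' _; rewrite mulrA.
  under eq_bigr => d' _ do rewrite stack_invK.
  rewrite (bigD1 d) //= eqxx mulr1 big1 ?addr0 // => d' dd'.
  by rewrite eq_sym (negPf dd') mulr0 mul0r.
under eq_bigr => d _ do rewrite vE2 mulrCA.
by rewrite -big_distrr /= vE.
Qed.

Hypothesis sphi : forall r d, smooth_fun (fun x => phi x r d).

Lemma smooth_fun_stack rg d : smooth_fun (fun x => stack x rg d).
Proof. exact: (smooth_fun_act rg.2 (sphi rg.1 d)). Qed.
Lemma smooth_fun_stack_det : smooth_fun stack_det. Proof. exact: (smooth_fun_gramdet smooth_fun_stack). Qed.
Lemma smooth_fun_stack_inv d r : smooth_fun (fun x => stack_inv x d r).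
Proof. exact: (smooth_fun_graminv smooth_fun_stack). Qed.

End Stack.

(** * Orbits *)

Section Orbits.
Variables (R : realType) (X : space R) (H : finGroupType) (act : smooth_act X H).

Lemma stab_index x : (#|rcosets (stab act x) [set: H]| * #|stab act x| = #|H|)%N.
Proof.
transitivity (#|stabG act x| * #|[set: H]%G : stabG act x|%g)%N; first exact: mulnC.
by rewrite Lagrange ?cardsT //; apply/fintype.subsetP => h; rewrite !inE.
Qed.

Lemma stab_rcoset_eq x g h : act x g = act x h ->
  (stab act x :* g = stab act x :* h)%g.
Proof.
by move=> /sact_eq gh; apply/(@rcoset_eqP _ (stabG act x)); rewrite mem_rcoset.
Qed.

Lemma card_stab_act x g : #|stab act (act x g)| = #|stab act x|.
Proof.
suff -> : stab act (act x g) = (stab act x :^ g)%g by rewrite cardJg.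
apply/setP => h; rewrite mem_conjg conjgE invgK.
apply/stabP/stabP; rewrite !sactM => e; first by rewrite e sactV.
by rewrite -[in RHS]e -[RHS]sactM mulVg sact1.
Qed.

(** A point of the moment curve used as a linear form: finitely many values of n
    separate the points of every orbit. *)
Definition moment (n : nat) (x : pt X) : R :=
  \sum_i crd i x * n%:R ^+ enum_rank i.

Lemma smooth_fun_moment n : smooth_fun (moment n).
Proof.
apply: smooth_fun_sum => i; apply: smooth_fun_mul; [exact: smooth_fun_crd | exact: smooth_fun_cst].
Qed.

Definition separated (n : nat) (x : pt X) : Prop :=
  forall g h, moment n (act x g) = moment n (act x h) -> act x g = act x h.

(** For fixed x, [moment n x] is a polynomial in n whose coefficients are the coordinates of x. Two
    distinct points of an orbit thus have a nonzero difference polynomial, and the product over all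
    pairs has a degree bounded independently of x. *)
Lemma exists_separated : exists N, forall x, exists2 n, (n < N)%N & separated n x.
Proof.
exists (#|H| * #|H| * #|idx X|).+2 => x.
apply: contrapT => nosep.
pose bad (gh : H * H) := ~~ `[< act x gh.1 = act x gh.2 >].
pose P (gh : H * H) : {poly R} :=
  \poly_(k < #|idx X|) \sum_(i | enum_rank i == k :> nat)
     (crd i (act x gh.1) - crd i (act x gh.2)).
have PE gh n : (P gh).[n%:R] = moment n (act x gh.1) - moment n (act x gh.2).
  rewrite horner_poly /moment -sumrB [RHS]sum_enum_val; apply: eq_bigr => k _.
  rewrite (big_pred1 (enum_val k)) => [|i /=].
    by rewrite enum_valK mulrBl.
  by rewrite (inj_eq val_inj) -(inj_eq enum_val_inj) enum_rankK.
have P0 gh : bad gh -> P gh != 0.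
  apply: contraNneq => Pgh0; apply/asboolP/crd_inj => i; apply/eqP; rewrite -subr_eq0.
  have := congr1 (fun p : {poly R} => p`_(enum_rank i)) Pgh0.
  rewrite coef0 coef_poly ltn_ord (big_pred1 i) => [->//|j /=].
  by rewrite (inj_eq val_inj) (inj_eq enum_rank_inj).
pose Q := \prod_(gh | bad gh) P gh.
have Q0 : Q != 0 by apply/prodf_neq0 => gh; exact: P0.
pose rs : seq R := [seq n%:R | n <- iota 0 (#|H| * #|H| * #|idx X|).+2].
have rs_uniq : uniq rs.
  by rewrite map_inj_uniq ?iota_uniq // => a b /eqP; rewrite eqr_nat => /eqP.
have rs_root : all (root Q) rs.
  apply/allP => _ /mapP[n nN ->]; rewrite /root horner_prod prodf_seq_eq0.
  apply/negP => /negP nbad; apply: nosep; exists n.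
    by move: nN; rewrite mem_iota.
  move=> g h gh; apply/asboolP; apply: contraR nbad => ngh.
  apply/hasP; exists (g, h); rewrite ?mem_index_enum //= {1}/bad ngh /=.
  by rewrite PE /= gh subrr.
have := max_poly_roots Q0 rs_root rs_uniq.
rewrite size_map size_iota ltnNge => /negP; apply.
rewrite size_prod; last exact: P0.
apply: (leq_trans (leq_subr _ _)); rewrite ltnS.
apply: (@leq_trans (\sum_(gh : H * H) #|idx X|)).
  rewrite [leqRHS](bigID bad) /=; apply: leq_trans (leq_addr _ _).
  by apply: leq_sum => gh _; exact: size_poly.
by rewrite sum_nat_const card_prod leqnSn.
Qed.

(** The polynomial with coefficients [v] has degree less than k and vanishes at the pairwise
    distinct moments of the orbit, of which there are at least k. *)
Lemma vandermonde n k x : separated n x -> (k * #|stab act x| <= #|H|)%N ->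
  forall v : 'I_k -> R,
  (forall g, \sum_(i < k) moment n (act x g) ^+ i * v i = 0) -> forall i, v i = 0.
Proof.
move=> sep; rewrite -(stab_index x) leq_pmul2r => [kle v v0|]; last first.
  exact: (cardG_gt0 (stabG act x)).
pose p := \poly_(i < k) (if insub i is Some j then v j else 0).
have p0 : p = 0.
  apply: contraTeq kle => pn0; rewrite -ltnNge.
  pose rs := [seq moment n (act x (repr A)) | A : {set H} <- enum (rcosets (stab act x) [set: H])].
  have repr_in A : A \in rcosets (stab act x) [set: H] -> A = (stab act x :* repr A)%g.
    by case/rcosetsP => g _ ->; rewrite (rcoset_repr (stabG act x)).
  have rs_uniq : uniq rs.
    rewrite map_inj_in_uniq ?enum_uniq // => A B.
    rewrite !mem_enum => /repr_in AE /repr_in BE /sep gAB.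
    by rewrite AE BE; exact: stab_rcoset_eq.
  have rs_root : all (root p) rs.
    apply/allP => _ /mapP[A _ ->]; apply/eqP; rewrite horner_poly.
    rewrite -[RHS](v0 (repr A)); apply: eq_bigr => i _.
    by rewrite valK mulrC.
  have := max_poly_roots pn0 rs_root rs_uniq.
  rewrite size_map -cardE => /leq_trans; apply; exact: size_poly.
move=> i; have := congr1 (fun q : {poly R} => q`_i) p0.
by rewrite coef0 coef_poly ltn_ord valK.
Qed.

End Orbits.

Section OrbitFrame.
Variables (R : realType) (X : space R) (H : finGroupType) (act : smooth_act X H).
Variables (o kappa : nat).
Hypothesis card_H : #|H| = (o * kappa)%N.

Definition fixdist (K : {set H}) (x : pt X) : R :=
  \sum_(k in K) \sum_i (crd i (act x k) - crd i x) ^+ 2.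

Lemma fixdist_eq0 K x : fixdist K x = 0 <-> K \subset stab act x.
Proof.
split=> [/eqP|/fintype.subsetP Kx]; last first.
  rewrite /fixdist big1 // => k /Kx /stabP kx; rewrite big1 // => i _.
  by rewrite kx subrr expr0n.
rewrite psumr_eq0 => [/allP K0|k _]; last by apply: sumr_ge0 => i _; exact: sqr_ge0.
apply/fintype.subsetP => k kK; apply/stabP/crd_inj => i.
have := K0 k; rewrite mem_index_enum kK => /(_ isT).
rewrite psumr_eq0 => [/allP/(_ i)|j _]; last exact: sqr_ge0.
by rewrite mem_index_enum sqrf_eq0 subr_eq0 => /(_ isT)/eqP.
Qed.

(** On the maximal stratum this is nonzero exactly when K is the isotropy group. *)
Definition stab_weight (K : {set H}) (x : pt X) : R :=
  \prod_(K' : {set H} | (#|K'| == kappa) && (K' != K)) fixdist K' x.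

(** At a point x of the maximal stratum, a basis indexed by t of the functions of
    the point x h of the orbit. It need not be equivariant in x. *)
Definition orbit_frame (x : pt X) (h : H) (t : 'I_o) : R :=
  \sum_(K : {set H} | #|K| == kappa)
    stab_weight K x * (h \in nth finset.set0 (enum (rcosets K [set: H])) t)%:R.

Lemma smooth_fun_orbit_frame h t : smooth_fun (fun x => orbit_frame x h t).
Proof.
apply: smooth_fun_sum => K; apply: smooth_fun_mul; last exact: smooth_fun_cst.
apply: smooth_fun_prod => K'; apply: smooth_fun_sum => k; apply: smooth_fun_sum => i.
apply: smooth_fun_exp; apply: smooth_fun_sub; last exact: smooth_fun_crd.
exact: smooth_fun_sact.
Qed.

Variables (x : pt X) (stab_x : #|stab act x| = kappa).

Let S := stab act x.

(** The weight of any other [K] contains the factor [fixdist S x], which vanishes. *)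
Lemma orbit_frameE h t :
  orbit_frame x h t = stab_weight S x * (h \in nth finset.set0 (enum (rcosets S [set: H])) t)%:R.
Proof.
rewrite /orbit_frame (bigD1 S) ?stab_x ?eqxx //= big1 ?addr0 // => K /andP[_ KS].
rewrite /stab_weight (bigD1 S) /=; last by rewrite stab_x eqxx eq_sym KS.
by have /fixdist_eq0 -> := fintype.subxx S; rewrite !mul0r.
Qed.

(** A set of order [kappa] fixing x lies in the stabilizer, which has the same order, and so equals
    it. *)
Lemma stab_weight_neq0 : stab_weight S x != 0.
Proof.
apply/prodf_neq0 => K /andP[/eqP cK KS]; apply: contraNneq KS => /fixdist_eq0 KsubS.
by rewrite finset.eqEcard KsubS cK -stab_x /=.
Qed.

Let size_o : #|rcosets S [set: H]| = o.
Proof.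
have := stab_index act x; rewrite card_H stab_x -/S => /eqP.
rewrite eqn_pmul2r => [/eqP -> //|].
by rewrite -stab_x; exact: (cardG_gt0 (stabG act x)).
Qed.

Let coset_t (t : 'I_o) := nth finset.set0 (enum (rcosets S [set: H])) t.

Let coset_tP t : coset_t t \in rcosets S [set: H].
Proof. by rewrite -mem_enum mem_nth // -cardE size_o. Qed.

Lemma orbit_frame_orbit h h' t : act x h = act x h' -> orbit_frame x h t = orbit_frame x h' t.
Proof.
move=> hh'; rewrite !orbit_frameE; congr (_ * _%:R).
have /rcosetsP[g _ tg] := coset_tP t; rewrite -/(coset_t t) tg.
have hS : (h * h'^-1)%g \in S by exact: sact_eq.
rewrite !mem_rcoset -[h](mulgKV h') -mulgA.
by rewrite (groupMl (G := stabG act x)).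
Qed.

Lemma orbit_frame_inj (v : 'I_o -> R) :
  (forall h, \sum_t orbit_frame x h t * v t = 0) -> forall t, v t = 0.
Proof.
move=> v0 t; have /rcosetsP[g _ tg] := coset_tP t.
have := v0 g; rewrite (bigD1 t) //= big1 ?addr0 => [|t' tt'].
  rewrite orbit_frameE -/(coset_t t) tg (rcoset_refl (stabG act x)) mulr1 => /eqP.
  by rewrite mulf_eq0 (negPf stab_weight_neq0) /= => /eqP.
rewrite orbit_frameE -/(coset_t t'); case: (boolP (_ \in _)) => [|_]; last by rewrite mulr0 mul0r.
have /rcosetsP[g' _ tg'] := coset_tP t'.
rewrite tg' => /(rcoset_eqP (G := stabG act x)) e.
case/eqP: tt'; apply/val_inj/eqP.
have size_e : size (enum (rcosets S [set: H])) = o by rewrite -cardE.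
rewrite -(nth_uniq finset.set0 _ _ (enum_uniq (mem (rcosets S [set: H])))) ?size_e ?ltn_ord //.
by rewrite -/(coset_t t) -/(coset_t t') tg tg' e.
Qed.

End OrbitFrame.

(** * Equivariant frames over the maximal isotropy stratum *)

Ltac smooth_fun_pullback :=
  match goal with
  | |- smooth_fun (fun x => ?f (sact ?a x ?h)) =>
      apply: (@smooth_fun_act _ _ _ a (fun y => f y) h)
  | |- smooth_fun (fun x => ?f (sact ?a x ?h) ?i) =>
      apply: (@smooth_fun_act _ _ _ a (fun y => f y i) h)
  | |- smooth_fun (fun x => ?f (sact ?a x ?h) ?i ?j) =>
      apply: (@smooth_fun_act _ _ _ a (fun y => f y i j) h)
  end.

Section LinearForms.
Variables (R : realType) (D : finType).

(** Linearity, stated so as to read off the matrix of the form. *)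
Definition linform (f : (D -> R) -> R) : Prop :=
  forall v, f v = \sum_d v d * f (fun d' => (d' == d)%:R).

Lemma linform_coef d : linform (fun v => v d).
Proof.
move=> v; rewrite (bigD1 d) //= eqxx mulr1 big1 ?addr0 // => d' dd'.
by rewrite eq_sym (negPf dd') mulr0.
Qed.

Lemma linform_add f g : linform f -> linform g -> linform (fun v => f v + g v).
Proof.
move=> lf lg v; rewrite lf lg -big_split; apply: eq_bigr => d _ /=.
by rewrite mulrDr.
Qed.

Lemma linform_scale k f : linform f -> linform (fun v => k * f v).
Proof.
by move=> lf v; rewrite lf big_distrr; apply: eq_bigr => d _; rewrite /= mulrCA.
Qed.

Lemma linform_opp f : linform f -> linform (fun v => - f v).
Proof.
by move=> lf v; rewrite lf -sumrN; apply: eq_bigr => d _; rewrite mulrN.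
Qed.

Lemma linform_sum (I : finType) (F : I -> (D -> R) -> R) :
  (forall i, linform (F i)) -> linform (fun v => \sum_i F i v).
Proof.
move=> lF v; under eq_bigr => i _ do rewrite lF.
by rewrite exchange_big; apply: eq_bigr => d _; rewrite big_distrr.
Qed.

End LinearForms.

Ltac linear_form :=
  repeat match goal with
  | |- linform (fun v => - _) => apply: linform_opp
  | |- linform (fun v => _ + _) => apply: linform_add
  | |- linform (fun v => \sum_i _) => apply: linform_sum => ?
  | |- linform (fun v => _ * _) => apply: linform_scale
  | |- linform (fun v => v _) => exact: linform_coef
  | |- _ => solve [auto]
  end.

Section Glue.
Variables (R : realType) (X : space R) (H : finGroupType) (act : smooth_act X H).
Variables (o kappa : nat).
Hypothesis card_H : #|H| = (o * kappa)%N.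

Local Notation T := ('I_o).
Variables (C : finType) (fa : pt X -> C -> C * T -> R) (fb : pt X -> unit -> T -> R).
Hypotheses (sfa : forall m e, smooth_fun (fun x => fa x m e))
           (sfb : forall r t, smooth_fun (fun x => fb x r t)).

Local Notation pa := (stack_inv act fa).
Local Notation pb := (stack_inv act fb).
Local Notation sa := (stack_det act fa).
Local Notation sb := (stack_det act fb).
Local Notation Bf := (orbit_frame act kappa).

Local Notation csec := (pt X -> C * T -> R).
Local Notation psec := (pt X -> C * T -> T -> R).

Definition pairing (c : csec) (h : H) (x : pt X) (m : C) : R :=
  \sum_t @orbit_frame _ _ _ act o kappa x h t * c x (m, t).

(** B stands for functions on the orbit and T for the trivial bundle of rank o;
    [C * T] carries m copies of T when [C] has m elements. The pair ([koszul1],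
    [koszul2]) maps T T + B B to B T + T B by the Koszul matrix (a, - b'; b, a'),
    where a section c of T B is first turned into the section [pairing c] of B B. *)
Definition koszul1 (p : psec) (c : csec) (x : pt X) (e : C * T) : R :=
  \sum_e' fa x e.1 e' * p x e' e.2
    + - \sum_h pb (act x h) e.2 tt * pairing c h x e.1.

Definition koszul2 (p : psec) (c : csec) (x : pt X) (e : C * T) : R :=
  \sum_t fb x tt t * p x e t
    + \sum_h \sum_m pa (act x h) e m * pairing c h^-1%g (act x h) m.

Definition retr (w1 w2 : psec) (x : pt X) (e : C * T) : R :=
  \sum_e' fa x e.1 e' * w1 x e' e.2 + \sum_t fb x tt t * w2 x e t.

Definition inc1 (c : csec) (x : pt X) (e : C * T) (t : T) : R :=
  \sum_h \sum_m pa (act x h) e m * c (act x h) (m, t).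

Definition inc2 (c : csec) (x : pt X) (e : C * T) (t : T) : R :=
  \sum_h pb (act x h) t tt * c (act x h) e.

Lemma inc1_act c x g e t : inc1 c (act x g) e t = inc1 c x e t.
Proof.
rewrite /inc1 [RHS](reindex_inj (mulgI g)); apply: eq_bigr => h _ /=.
by rewrite sactM.
Qed.

Lemma inc2_act c x g e t : inc2 c (act x g) e t = inc2 c x e t.
Proof.
rewrite /inc2 [RHS](reindex_inj (mulgI g)); apply: eq_bigr => h _ /=.
by rewrite sactM.
Qed.

Variables (x : pt X) (stab_x : #|stab act x| = kappa).

Let stab_xg g : #|stab act (act x g)| = kappa.
Proof. by rewrite card_stab_act. Qed.

Let pairing_orbit c g h h' m : act (act x g) h = act (act x g) h' ->
  pairing c h (act x g) m = pairing c h' (act x g) m.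
Proof.
by move=> e; apply: eq_bigr => t _; rewrite (orbit_frame_orbit card_H (stab_xg g) _ e).
Qed.

Let pairing_eq0 c g m : (forall h, pairing c h (act x g) m = 0) ->
  forall t, c (act x g) (m, t) = 0.
Proof. exact: (orbit_frame_inj card_H (stab_xg g)). Qed.

Let card_a g : (#|{: C * T}| * #|stab act (act x g)| = #|C| * #|H|)%N.
Proof. by rewrite stab_xg card_prod card_ord card_H mulnA. Qed.

Let card_b g : (#|{: T}| * #|stab act (act x g)| = #|{: unit}| * #|H|)%N.
Proof. by rewrite stab_xg card_ord card_unit mul1n card_H. Qed.

(** Apply a' to the first row and b' to the second. The contributions of [p] become [sa x * p] and
    [sb x * p]; those of [c] are both [Z] up to opposite signs, because a' and b' act on different
    tensor factors. Adding gives [(sa x + sb x) * p = 0]. Once [p] is zero, one row determines [c],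
    since on the maximal stratum a' or b' is invertible. *)
Lemma koszul_inj p c : (forall g e t, p (act x g) e t = p x e t) ->
  0 < sa x + sb x ->
  (forall g e, koszul1 p c (act x g) e = 0) ->
  (forall g e, koszul2 p c (act x g) e = 0) ->
  (forall e t, p x e t = 0) /\ (forall g e, c (act x g) e = 0).
Proof.
move=> pinv spos k1 k2.
pose Z e t := \sum_g \sum_m pa (act x g) e m *
   \sum_h pb (act x h) t tt * pairing c (g^-1 * h)%g (act x g) m.
have E1 e t : sa x * p x e t = Z e t.
  have : \sum_g \sum_m pa (act x g) e m * koszul1 p c (act x g) (m, t) = 0.
    by rewrite big1 // => g _; rewrite big1 // => m _; rewrite k1 mulr0.
  under eq_bigr => g _.
    under eq_bigr => m _ do rewrite /koszul1 /= mulrDr.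
    rewrite big_split /=; over.
  rewrite big_split /= => /eqP; rewrite addr_eq0 => /eqP E.
  transitivity (\sum_g \sum_m pa (act x g) e m *
     \sum_e' fa (act x g) m e' * p (act x g) e' t); last first.
    rewrite E -sumrN; apply: eq_bigr => g _; rewrite -sumrN; apply: eq_bigr => m _.
    rewrite -mulrN opprK; congr (_ * _).
    rewrite [RHS](reindex_inj (mulgI g)); apply: eq_bigr => h _ /=.
    by rewrite sactM mulKg.
  transitivity (\sum_e' (\sum_g \sum_m pa (act x g) e m * fa (act x g) m e') * p x e' t).
    under eq_bigr => e' _ do rewrite stack_invK.
    rewrite (bigD1 e) //= eqxx mulr1 big1 ?addr0 // => e' ee'.
    by rewrite eq_sym (negPf ee') mulr0 mul0r.
  under eq_bigr => e' _ do rewrite big_distrl /=.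
  rewrite exchange_big; apply: eq_bigr => g _ /=.
  under eq_bigr => e' _ do rewrite big_distrl /=.
  rewrite exchange_big; apply: eq_bigr => m _ /=.
  by rewrite big_distrr; apply: eq_bigr => e' _ /=; rewrite mulrA pinv.
have E2 e t : sb x * p x e t = - Z e t.
  have : \sum_g pb (act x g) t tt * koszul2 p c (act x g) e = 0.
    by rewrite big1 // => g _; rewrite k2 mulr0.
  under eq_bigr => g _ do rewrite /koszul2 /= mulrDr.
  rewrite big_split /= => /eqP; rewrite addr_eq0 => /eqP E.
  transitivity (\sum_g pb (act x g) t tt * \sum_t' fb (act x g) tt t' * p (act x g) e t').
    transitivity (\sum_t' (\sum_g \sum_r pb (act x g) t r * fb (act x g) r t') * p x e t').
      under eq_bigr => t' _ do rewrite stack_invK.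
      rewrite (bigD1 t) //= eqxx mulr1 big1 ?addr0 // => t' tt'.
      by rewrite eq_sym (negPf tt') mulr0 mul0r.
    under eq_bigr => t' _ do rewrite big_distrl /=.
    rewrite exchange_big; apply: eq_bigr => g _ /=.
    rewrite big_distrr; apply: eq_bigr => t' _ /=.
    by rewrite (big_pred1 tt) => [|[]] //; rewrite mulrA pinv.
  rewrite E; congr (- _).
  under eq_bigr => h _.
    rewrite (reindex_inj (mulgI h^-1%g)) big_distrr /=.
    under eq_bigr => g _ do rewrite -sactM mulKVg invMg invgK big_distrr /=.
    over.
  rewrite exchange_big; apply: eq_bigr => g _ /=.
  rewrite exchange_big; apply: eq_bigr => m _ /=.
  by rewrite big_distrr; apply: eq_bigr => h _ /=; rewrite mulrCA.
have p0 e t : p x e t = 0.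
  apply/eqP; rewrite -(mulrI_eq0 _ (lregP (lt0r_neq0 spos))) mulrDl E1 E2.
  by rewrite subrr.
split=> // g [m t].
(* Where b is invertible the first row yields [c = 0]; otherwise a is invertible and the second row
   does. *)
have [sb0|sb0] := eqVneq (sb x) 0; last first.
  apply: pairing_eq0 => h.
  pose u h (r : unit) := pairing c h (act x g) m.
  have ou : orbit_fun act (act x g) u by move=> h1 h2 e r; exact: pairing_orbit.
  have := stack_invKV fb (card_b g) ou h tt.
  rewrite stack_det_act big1 => [/esym/eqP|t' _].
    by rewrite mulf_eq0 (negPf sb0) /u => /eqP.
  have := k1 g (m, t'); rewrite /koszul1 /= big1 ?add0r => [/eqP|e' _]; last first.
    by rewrite pinv p0 mulr0.
  rewrite oppr_eq0 => /eqP E; rewrite (_ : \sum_(g' : H) _ = 0) ?mulr0 // -[RHS]E.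
  by apply: eq_bigr => h' _; rewrite (big_pred1 tt) => [|[]].
have sa0 : sa x != 0 by move: spos; rewrite sb0 addr0 => /lt0r_neq0.
apply: pairing_eq0 => k.
(* The second row pairs at h^-1 from the point moved by h. Based at x g k, the choice h = k^-1
   recovers the pairing at k from x g. *)
pose u h m' := pairing c h^-1%g (act (act x (g * k)%g) h) m'.
have ou : orbit_fun act (act x (g * k)%g) u.
  move=> h1 h2 e r; rewrite /u e -sactM; apply: pairing_orbit.
  by rewrite [act x _]sactM -{1}e !sactV.
have := stack_invKV fa (x := act x (g * k)%g) (card_a (g * k)%g) ou k^-1%g m.
rewrite stack_det_act big1 => [/esym/eqP|e' _].
  by rewrite mulf_eq0 (negPf sa0) /u /= invgK -sactM mulgK => /eqP.
have := k2 (g * k)%g e'; rewrite /koszul2 big1 ?add0r => [E|t' _]; last first.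
  by rewrite pinv p0 mulr0.
by rewrite [X in _ * X](_ : _ = 0) ?mulr0 //; exact: E.
Qed.

(** On the maximal stratum a a' and b b' are multiplication by [sa] and [sb] on orbit functions.
    Adding the two keeps the factor positive wherever either frame is invertible. *)
Lemma retr_inc c g e :
  retr (inc1 c) (inc2 c) (act x g) e = (sa x + sb x) * c (act x g) e.
Proof.
rewrite mulrDl -(stack_det_act act fa x g) -(stack_det_act act fb x g); congr (_ + _).
  have ou : orbit_fun act (act x g) (fun h m => c (act (act x g) h) (m, e.2)).
    by move=> h h' eh m; rewrite eh.
  have := stack_invKV fa (card_a g) ou 1%g e.1.
  by rewrite !sact1 -surjective_pairing.
have ou : orbit_fun act (act x g) (fun h (r : unit) => c (act (act x g) h) e).
  by move=> h h' eh m; rewrite eh.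
have := stack_invKV fb (card_b g) ou 1%g tt.
rewrite !sact1 => <-; apply: eq_bigr => t _; congr (_ * _).
by apply: eq_bigr => h _; rewrite (big_pred1 tt) => [|[]].
Qed.

End Glue.

Section GlueStep.
Variables (R : realType) (X : space R) (H : finGroupType) (act : smooth_act X H).
Variables (o kappa : nat).
Hypothesis card_H : #|H| = (o * kappa)%N.
Local Notation T := ('I_o).
Variables (C : finType) (fa : pt X -> C -> C * T -> R) (fb : pt X -> unit -> T -> R).
Hypotheses (sfa : forall m e, smooth_fun (fun x => fa x m e))
           (sfb : forall r t, smooth_fun (fun x => fb x r t)).

Local Notation C' := ('I_3 * (C * T))%type.
Local Notation csec := (pt X -> C * T -> R).
Local Notation psec := (pt X -> C * T -> T -> R).
Local Notation k1 := (koszul1 act kappa fa fb).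
Local Notation k2 := (koszul2 act kappa fa fb).
Local Notation rr := (retr fa fb).
Local Notation i1 := (inc1 act fa).
Local Notation i2 := (inc2 act fb).

(** Let r be the retraction [retr] of T T + T T onto B T, with section [inc1], [inc2].
    The map below sends three copies of P = T T to three copies of Q = B T: first
    P + (P + P) -> Q + (P + P), which is P + Q -> Q + Q transferred along r, and then
    twice Q + P -> Q + Q. *)
Section Vector.
Variable v : C' * T -> R.
Definition input (k : 'I_3) : psec := fun x e t => v ((k, e), t).
Definition glue_c0 : csec := rr (input 1) (input 2).
Definition glue_c1 : csec := k1 (input 0) glue_c0.
Definition glue_c2 : csec := k2 (input 0) glue_c0.
Definition glue_w1 : psec := fun x e t =>
  i1 glue_c2 x e t + (stack_det act fa x + stack_det act fb x) * input 1 x e t + - i1 glue_c0 x e t.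
Definition glue_w2 : psec := fun x e t =>
  i2 glue_c2 x e t + (stack_det act fa x + stack_det act fb x) * input 2 x e t + - i2 glue_c0 x e t.
Definition glue_d1 : csec := k1 glue_w1 glue_c1.
Definition glue_d2 : csec := k2 glue_w1 glue_c1.
Definition glue_out (x : pt X) (ke : C') : R :=
  if ke.1 == 0 then k1 glue_w2 glue_d1 x ke.2
  else if ke.1 == 1 then k2 glue_w2 glue_d1 x ke.2
  else glue_d2 x ke.2.
End Vector.

Definition glue (x : pt X) (ke : C') (d : C' * T) : R :=
  glue_out (fun d' => (d' == d)%:R) x ke.

Lemma linform_koszul1 (p : (C' * T -> R) -> psec) (c : (C' * T -> R) -> csec) :
  (forall x e t, linform (fun v => p v x e t)) ->
  (forall x e, linform (fun v => c v x e)) ->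
  forall x e, linform (fun v => k1 (p v) (c v) x e).
Proof. by move=> lp lc x e; rewrite /koszul1 /pairing; linear_form. Qed.

Lemma linform_koszul2 (p : (C' * T -> R) -> psec) (c : (C' * T -> R) -> csec) :
  (forall x e t, linform (fun v => p v x e t)) ->
  (forall x e, linform (fun v => c v x e)) ->
  forall x e, linform (fun v => k2 (p v) (c v) x e).
Proof. by move=> lp lc x e; rewrite /koszul2 /pairing; linear_form. Qed.

Lemma linform_glue_out x ke : linform (fun v => glue_out v x ke).
Proof.
have l0 x' e : linform (fun v => glue_c0 v x' e).
  by rewrite /glue_c0 /retr /input; linear_form.
have lin k x' e t : linform (fun v => input v k x' e t) by exact: linform_coef.
have l1 x' e : linform (fun v => glue_c1 v x' e) by exact: linform_koszul1.
have l2 x' e : linform (fun v => glue_c2 v x' e) by exact: linform_koszul2.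
have lw1 x' e t : linform (fun v => glue_w1 v x' e t).
  by rewrite /glue_w1 /inc1; linear_form.
have lw2 x' e t : linform (fun v => glue_w2 v x' e t).
  by rewrite /glue_w2 /inc2; linear_form.
have ld1 x' e : linform (fun v => glue_d1 v x' e) by exact: linform_koszul1.
have ld2 x' e : linform (fun v => glue_d2 v x' e) by exact: linform_koszul2.
rewrite /glue_out; case: eqP => _; first exact: linform_koszul1.
by case: eqP => _ //; exact: linform_koszul2.
Qed.

Lemma smooth_fun_koszul1 (p : psec) (c : csec) :
  (forall e t, smooth_fun (fun x => p x e t)) -> (forall e, smooth_fun (fun x => c x e)) ->
  forall e, smooth_fun (fun x => k1 p c x e).
Proof.
move=> sp sc e; rewrite /koszul1 /pairing; smooth.
  by smooth_fun_pullback; exact: smooth_fun_stack_inv.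
exact: smooth_fun_orbit_frame.
Qed.

Lemma smooth_fun_koszul2 (p : psec) (c : csec) :
  (forall e t, smooth_fun (fun x => p x e t)) -> (forall e, smooth_fun (fun x => c x e)) ->
  forall e, smooth_fun (fun x => k2 p c x e).
Proof.
move=> sp sc e; rewrite /koszul2 /pairing; smooth.
- by smooth_fun_pullback; exact: smooth_fun_stack_inv.
- by smooth_fun_pullback; exact: smooth_fun_orbit_frame.
- by smooth_fun_pullback; exact: sc.
Qed.

Lemma smooth_fun_glue ke d : smooth_fun (fun x => glue x ke d).
Proof.
set v := fun d' : C' * T => (d' == d)%:R : R.
have s0 e : smooth_fun (fun x => glue_c0 v x e).
  by rewrite /glue_c0 /retr /input; smooth.
have sin k e t : smooth_fun (fun x => input v k x e t) by exact: smooth_fun_cst.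
have s1 e : smooth_fun (fun x => glue_c1 v x e) by exact: smooth_fun_koszul1.
have s2 e : smooth_fun (fun x => glue_c2 v x e) by exact: smooth_fun_koszul2.
have sa := smooth_fun_stack_det act sfa; have sb := smooth_fun_stack_det act sfb.
have sw1 e t : smooth_fun (fun x => glue_w1 v x e t).
  rewrite /glue_w1 /inc1; smooth.
  - by smooth_fun_pullback; exact: smooth_fun_stack_inv.
  - by smooth_fun_pullback; exact: s2.
  - by smooth_fun_pullback; exact: smooth_fun_stack_inv.
  - by smooth_fun_pullback; exact: s0.
have sw2 e t : smooth_fun (fun x => glue_w2 v x e t).
  rewrite /glue_w2 /inc2; smooth.
  - by smooth_fun_pullback; exact: smooth_fun_stack_inv.
  - by smooth_fun_pullback; exact: s2.
  - by smooth_fun_pullback; exact: smooth_fun_stack_inv.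
  - by smooth_fun_pullback; exact: s0.
have sd1 e : smooth_fun (fun x => glue_d1 v x e) by exact: smooth_fun_koszul1.
have sd2 e : smooth_fun (fun x => glue_d2 v x e) by exact: smooth_fun_koszul2.
rewrite /glue /glue_out -/v; case: (ke.1 == 0); first exact: smooth_fun_koszul1.
by case: (ke.1 == 1) => //; exact: smooth_fun_koszul2.
Qed.

Lemma retr_comb r x (w1 w2 a1 a2 b1 b2 c1 c2 : psec) :
  (forall e t, w1 x e t = a1 x e t + r * b1 x e t + - c1 x e t) ->
  (forall e t, w2 x e t = a2 x e t + r * b2 x e t + - c2 x e t) ->
  forall e, rr w1 w2 x e = rr a1 a2 x e + r * rr b1 b2 x e - rr c1 c2 x e.
Proof.
move=> E1 E2 e.
have comb (I : finType) (f a b c : I -> R) :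
    \sum_i f i * (a i + r * b i + - c i) =
    \sum_i f i * a i + r * \sum_i f i * b i - \sum_i f i * c i.
  rewrite big_distrr /= -big_split -sumrB; apply: eq_bigr => i _ /=; ring.
rewrite /retr.
under eq_bigr => e' _ do rewrite E1.
under [X in _ + X = _]eq_bigr => t _ do rewrite E2.
rewrite !comb; ring.
Qed.

(** The composition is undone from its end: three uses of [koszul_inj], with the retraction identity
    between the second and the third. *)
Lemma glue_inj x : #|stab act x| = kappa -> stack_inj act fa x \/ stack_inj act fb x ->
  stack_inj act glue x.
Proof.
move=> stab_x fab; apply/stack_injP => v v0.
set rho := stack_det act fa x + stack_det act fb x.
have rho0 : 0 < rho.
  case: fab => /stack_det_gt0 s; rewrite /rho; first by rewrite ltr_wpDr // stack_det_ge0.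
  by rewrite ltr_wpDl // stack_det_ge0.
have out0 g ke : glue_out v (act x g) ke = 0.
  rewrite -[RHS](v0 g ke) linform_glue_out.
  by apply: eq_bigr => d _; rewrite mulrC.
have w1inv g e t : glue_w1 v (act x g) e t = glue_w1 v x e t.
  by rewrite /glue_w1 !inc1_act !stack_det_act.
have w2inv g e t : glue_w2 v (act x g) e t = glue_w2 v x e t.
  by rewrite /glue_w2 !inc2_act !stack_det_act.
have [w20 d10] := koszul_inj card_H stab_x w2inv rho0
  (fun g e => out0 g (0, e)) (fun g e => out0 g (1, e)).
have [w10 c10] := koszul_inj card_H stab_x w1inv rho0
  d10 (fun g e => out0 g (2, e)).
(* Apply the retraction to [glue_w1] and [glue_w2], which vanish. As [glue_c0] is the retraction of
   inputs 1 and 2, the last two terms of the w's cancel and [rho * glue_c2] remains. *)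
have c20 g e : glue_c2 v (act x g) e = 0.
  have : rr (glue_w1 v) (glue_w2 v) (act x g) e = 0.
    rewrite /retr big1 => [|e' _]; last by rewrite w1inv w10 mulr0.
    by rewrite big1 ?addr0 // => t _; rewrite w2inv w20 mulr0.
  rewrite (@retr_comb rho _ _ _ (i1 (glue_c2 v)) (i2 (glue_c2 v)) (input v 1) (input v 2)
     (i1 (glue_c0 v)) (i2 (glue_c0 v))); first last.
  - by move=> e' t; rewrite /glue_w2 !stack_det_act.
  - by move=> e' t; rewrite /glue_w1 !stack_det_act.
  rewrite !(retr_inc card_H fa fb stab_x) -/rho addrK => /eqP.
  by rewrite mulf_eq0 (negPf (lt0r_neq0 rho0)) /= => /eqP.
have inpinv k g e t : input v k (act x g) e t = input v k x e t by [].
have [p0 c00] : (forall e t, input v 0 x e t = 0) /\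
    (forall g e, glue_c0 v (act x g) e = 0).
  exact: (koszul_inj card_H stab_x (inpinv 0) rho0 c10 c20).
have w1E e t : input v 1 x e t = 0.
  have := w10 e t; rewrite /glue_w1 {1}/inc1 big1 => [|h _]; last first.
    by rewrite big1 // => m _; rewrite c20 mulr0.
  rewrite /inc1 [X in _ - X]big1 => [|h _]; last first.
    by rewrite big1 // => m _; rewrite c00 mulr0.
  by rewrite add0r subr0 => /eqP; rewrite mulf_eq0 (negPf (lt0r_neq0 rho0)) => /eqP.
have w2E e t : input v 2 x e t = 0.
  have := w20 e t; rewrite /glue_w2 {1}/inc2 big1 => [|h _]; last by rewrite c20 mulr0.
  rewrite /inc2 [X in _ - X]big1 => [|h _]; last by rewrite c00 mulr0.
  by rewrite add0r subr0 => /eqP; rewrite mulf_eq0 (negPf (lt0r_neq0 rho0)) => /eqP.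
move=> [[k e] t]; case: (ltngtP k 1%N) => k1.
- by rewrite (_ : k = 0) ?[LHS]p0 //; apply/val_inj => /=; lia.
- by rewrite (_ : k = 2) ?[LHS]w2E //; apply/val_inj => /=; have := ltn_ord k; lia.
- by rewrite (_ : k = 1) ?[LHS]w1E //; apply/val_inj.
Qed.

End GlueStep.

Section MaximalStratum.
Variables (R : realType) (X : space R) (H : finGroupType) (act : smooth_act X H).
Variables (o kappa : nat).
Hypothesis card_H : #|H| = (o * kappa)%N.

Definition moment_frame (k n : nat) (x : pt X) (r : unit) (t : 'I_k) : R :=
  moment n x ^+ t.

Lemma smooth_fun_moment_frame k n r t : smooth_fun (fun x => @moment_frame k n x r t).
Proof. by apply: smooth_fun_exp; exact: smooth_fun_moment. Qed.

Lemma moment_frame_inj k n x : separated act n x ->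
  (k * #|stab act x| <= #|H|)%N -> stack_inj act (@moment_frame k n) x.
Proof. by move=> sep kle; apply/stack_injP => v v0; apply: (vandermonde sep kle) => g; exact: v0. Qed.

(** The moment frame of index n is invertible where moment n separates the orbit. Finitely many
    indices cover the stratum, and each is absorbed by one [glue]. *)
Lemma frame_max_stratum : exists (C : finType) (f : pt X -> C -> C * 'I_o -> R),
  [/\ (0 < #|C|)%N, forall m e, smooth_fun (fun x => f x m e) &
     forall x, #|stab act x| = kappa -> stack_inj act f x].
Proof.
have [N sepN] := exists_separated act.
suff main : forall n, exists (C : finType) (f : pt X -> C -> C * 'I_o -> R),
  [/\ (0 < #|C|)%N, forall m e, smooth_fun (fun x => f x m e) &
     forall x, #|stab act x| = kappa -> (exists2 k, (k < n)%N & separated act k x) ->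
       stack_inj act f x].
  have [C [f [C0 sf vf]]] := main N; exists C, f; split=> // x stab_x.
  exact: vf.
elim=> [|n [C [f [C0 sf vf]]]].
  exists unit, (fun _ _ _ => 0); split=> [|m e|x _ []//]; first by rewrite card_unit.
  exact: smooth_fun_cst.
have [zo|lto] := posnP o.
  exists C, f; split=> // x _ _; apply/stack_injP => v v0 [m t].
  by have := ltn_ord t; rewrite [X in (_ < X)%N]zo.
exists ('I_3 * (C * 'I_o))%type, (glue act kappa f (@moment_frame o n)); split.
- by rewrite !card_prod !card_ord !muln_gt0 C0 lto.
- by move=> m e; apply: smooth_fun_glue => // r t; exact: smooth_fun_moment_frame.
move=> x stab_x [k]; rewrite ltnS leq_eqVlt => /orP[/eqP ->|kn] sepk.
  apply: glue_inj => //; right; apply: moment_frame_inj => //.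
  by rewrite stab_x card_H.
by apply: glue_inj => //; left; apply: vf => //; exists k.
Qed.

End MaximalStratum.

(** * Equivariant frames everywhere *)

Section Slack.
Variables (R : realType) (X : space R) (H : finGroupType) (act : smooth_act X H).
Variable (o : nat).
Local Notation T := ('I_o).
Variables (C : finType) (fa : pt X -> C -> C * T -> R)
          (fb : pt X -> unit -> 'I_(o + o) -> R).
Hypotheses (sfa : forall m e, smooth_fun (fun x => fa x m e))
           (sfb : forall r t, smooth_fun (fun x => fb x r t)).

Local Notation J := ((C * T) * (C * 'I_(o + o)))%type.
Local Notation C' := ('I_#|{: J}|.+1 * C)%type.

(** The default 0 ends the chain: the last slot refers to a variable y_(j+2) that is out of
    range. *)
Definition slack_var (v : C' * T -> R) (n : nat) (e : C * T) : R :=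
  if insub n is Some j then v ((j, e.1), e.2) else 0.

(** Where [margin] is positive a is injective, where it is negative b is, and where
    it vanishes both are. *)
Definition margin (x : pt X) : R := stack_det act fa x - stack_det act fb x.

(** Slot 0 carries a y_0 on the positive side and b (y_0, y_1) on the negative side.
    On the negative side slot j then carries b y_(j+1), and all y_j vanish in turn.
    On the wall, where slot 0 is empty, y_0 is recovered from the remaining slots:
    for every coordinate i and every column k of b they contain y_0(i) b(e_k)
    modulo the image of a, which has smaller rank than b. *)
Definition slack_glue_out (v : C' * T -> R) (x : pt X) (jm : C') : R :=
  let y := slack_var v in let m := jm.2 in
  if unlift ord0 jm.1 is Some j then
    let ik : J := enum_val j in
    \sum_e fa x m e * y j.+1 e
      + ((m == ik.2.1)%:R * fb x tt ik.2.2) * y 0%N ik.1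
      + flat 0 (- margin x) * \sum_t fb x tt (lshift o t) * y j.+2 (m, t)
  else
    flat 0 (margin x) * \sum_e fa x m e * y 0%N e
      + flat 0 (- margin x) * (\sum_t fb x tt (lshift o t) * y 0%N (m, t)
                              + \sum_t fb x tt (rshift o t) * y 1%N (m, t)).

Definition slack_glue (x : pt X) (jm : C') (d : C' * T) : R :=
  slack_glue_out (fun d' => (d' == d)%:R) x jm.

Lemma linform_slack_var n e : linform (fun v => slack_var v n e).
Proof.
rewrite /slack_var; case: (insub n) => [j|]; first exact: linform_coef.
by move=> v; rewrite big1 // => d _; rewrite mulr0.
Qed.

Lemma linform_slack_glue_out x jm : linform (fun v => slack_glue_out v x jm).
Proof.
have l := linform_slack_var.
by rewrite /slack_glue_out; case: (unlift _ _) => [j|]; linear_form.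
Qed.

Lemma smooth_fun_slack_glue jm d : smooth_fun (fun x => slack_glue x jm d).
Proof.
have sm : smooth_fun margin by apply: smooth_fun_sub; exact: smooth_fun_stack_det.
rewrite /slack_glue /slack_glue_out; case: (unlift _ _) => [j|]; smooth.
Qed.

Lemma flat_gt0 (t : R) : 0 < t -> 0 < flat 0 t.
Proof. by rewrite /flat expr0 mul1r => ->; exact: expR_gt0. Qed.

Lemma flat_le0 k (t : R) : t <= 0 -> flat k t = 0.
Proof. by rewrite /flat ltNge => ->. Qed.

Lemma slack_glue_inj x : stack_inj act fa x \/ stack_inj act fb x -> stack_inj act slack_glue x.
Proof.
move=> vab; apply/stack_injP => v v0.
have out0 g jm : slack_glue_out v (act x g) jm = 0.
  rewrite -[RHS](v0 g jm) linform_slack_glue_out.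
  by apply: eq_bigr => d _; rewrite mulrC.
set y := slack_var v.
have margin_act g : margin (act x g) = margin x by rewrite /margin !stack_det_act.
have slot0 g m : flat 0 (margin x) * \sum_e fa (act x g) m e * y 0%N e
      + flat 0 (- margin x) * (\sum_t fb (act x g) tt (lshift o t) * y 0%N (m, t)
                   + \sum_t fb (act x g) tt (rshift o t) * y 1%N (m, t)) = 0.
  by have := out0 g (ord0, m); rewrite /slack_glue_out unlift_none margin_act.
have slotS g m (j : 'I_#|{: J}|) :
    \sum_e fa (act x g) m e * y j.+1 e
      + ((m == (enum_val j).2.1)%:R * fb (act x g) tt (enum_val j).2.2) * y 0%N (enum_val j).1
      + flat 0 (- margin x) * \sum_t fb (act x g) tt (lshift o t) * y j.+2 (m, t) = 0.
  by have := out0 g (lift ord0 j, m); rewrite /slack_glue_out liftK margin_act.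
have y_out n e : (#|{: J}| < n)%N -> y n e = 0.
  by rewrite /y /slack_var; case: insubP => // j; rewrite ltnS ltnNge => ->.
suff y0 n e : y n e = 0.
  move=> [[j m] t]; have := y0 j (m, t); rewrite /y /slack_var /=.
  by rewrite valK.
have ga : 0 < stack_det act fa x -> forall w : C * T -> R,
    (forall g m, \sum_e fa (act x g) m e * w e = 0) -> forall e, w e = 0.
  by move=> /stack_det_gt0/stack_injP.
have gb : 0 < stack_det act fb x -> forall u w : T -> R,
    (forall g, \sum_t fb (act x g) tt (lshift o t) * u t
      + \sum_t fb (act x g) tt (rshift o t) * w t = 0) ->
    (forall t, u t = 0) /\ (forall t, w t = 0).
  move=> /stack_det_gt0/stack_injP vb u w uw0.
  have s0' := vb (fun k : 'I_(o + o) => match fintype.split k with inl t => u t | inr t => w t end).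
  have s0 : forall k : 'I_(o + o), match fintype.split k with inl t => u t | inr t => w t end = 0.
    apply: s0' => g []; rewrite -[RHS](uw0 g) big_split_ord /=.
    congr (_ + _); apply: eq_bigr => t _; congr (_ * _).
      by rewrite (unsplitK (inl t)).
    by rewrite (unsplitK (inr t)).
  split=> t; first by have := s0 (lshift o t); rewrite (unsplitK (inl t)).
  by have := s0 (rshift o t); rewrite (unsplitK (inr t)).
have sab : 0 < stack_det act fa x \/ 0 < stack_det act fb x.
  by case: vab => /stack_det_gt0; [left|right].
have [m0|m0|m0] := ltrgt0P (margin x).
- have sa0 : 0 < stack_det act fa x.
    by move: m0; rewrite subr_gt0; apply: le_lt_trans; exact: stack_det_ge0.
  have f0 : flat 0 (- margin x) = 0 by apply: flat_le0; rewrite oppr_le0 ltW.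
  have y00 e' : y 0%N e' = 0.
    apply: ga => // g m; have := slot0 g m; rewrite f0 mul0r addr0 => /eqP.
    by rewrite mulf_eq0 (negPf (lt0r_neq0 (flat_gt0 m0))) => /eqP.
  case: n => // n; have [nJ|] := ltnP n #|{: J}|; last by move=> nJ; rewrite y_out.
  apply: (ga sa0) => g m; have := slotS g m (Ordinal nJ).
  by rewrite f0 mul0r addr0 y00 mulr0 addr0.
- have sb0 : 0 < stack_det act fb x.
    by move: m0; rewrite subr_lt0; apply: le_lt_trans; exact: stack_det_ge0.
  have f0 : flat 0 (margin x) = 0 by apply: flat_le0; exact: ltW.
  have f1 : 0 < flat 0 (- margin x) by apply: flat_gt0; rewrite oppr_gt0.
  have y01 m : (forall t, y 0%N (m, t) = 0) /\ (forall t, y 1%N (m, t) = 0).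
    apply: gb => // g; have := slot0 g m; rewrite f0 mul0r add0r => /eqP.
    by rewrite mulf_eq0 (negPf (lt0r_neq0 f1)) => /eqP.
  have y00 e' : y 0%N e' = 0 by case: e' => m t; exact: (y01 m).1.
  case: n e => [|n] e; first exact: y00.
  elim: n e => [[m t]|n IH e]; first exact: (y01 m).2.
  have [nJ|nJ] := ltnP n #|{: J}|; last by apply: y_out; rewrite ltnS ltnW.
  case: e => m t.
  suff [-> //] : (forall t, y n.+2 (m, t) = 0) /\ (forall t : T, 0 = 0 :> R).
  apply: (gb sb0 (fun t => y n.+2 (m, t)) (fun=> 0)) => g; have := slotS g m (Ordinal nJ); rewrite y00 mulr0 addr0.
  rewrite big1 ?add0r => [/eqP|e _]; last by rewrite IH mulr0.
  rewrite mulf_eq0 (negPf (lt0r_neq0 f1)) => /eqP /= ->.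
  by rewrite add0r big1 // => t' _; rewrite mulr0.
- have ab : stack_det act fa x = stack_det act fb x by apply/eqP; rewrite -subr_eq0 -/(margin x) m0.
  have sa0 : 0 < stack_det act fa x by case: sab; rewrite ?ab.
  have sb0 : 0 < stack_det act fb x by rewrite -ab.
  have f0 : flat 0 (- margin x) = 0 by rewrite m0 oppr0 flat_le0.
  have y00 i : y 0%N i = 0.
    apply/eqP/negPn/negP => zi.
    (* Dividing the slots (i, k) by y_0(i) factors the block matrix of copies of b as a times [Y].
       Since b is injective so is [Y], yet it has twice as many columns as rows. *)
    pose Y e (k : C * 'I_(o + o)) := - y (enum_rank ((i, k) : J)).+1 e / y 0%N i.
    have Yeq g m k : \sum_e fa (act x g) m e * Y e k = (m == k.1)%:R * fb (act x g) tt k.2.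
      have := slotS g m (enum_rank ((i, k) : J)).
      rewrite f0 mul0r addr0 enum_rankK /= => /eqP; rewrite addr_eq0 => /eqP E.
      apply: (mulIf zi); rewrite big_distrl /=.
      under eq_bigr => e' _ do rewrite /Y -mulrA divfK // mulrN.
      by rewrite sumrN E opprK.
    have injY : inj_mx Y.
      move=> u Yu0 [m k].
      suff [ul ur] : (forall t, u (m, lshift o t) = 0) /\ (forall t, u (m, rshift o t) = 0).
        by rewrite -(splitK k); case: (fintype.split k) => t; [exact: ul|exact: ur].
      apply: (gb sb0) => g; rewrite [LHS](_ : _ = \sum_(k' < o + o) fb (act x g) tt k' * u (m, k')); last first.
        by rewrite big_split_ord.
      transitivity (\sum_k (\sum_e fa (act x g) m e * Y e k) * u k).
        under [RHS]eq_bigr => k' _ do rewrite Yeq.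
        rewrite [RHS](_ : _ = \sum_m' \sum_k' (m == m')%:R * fb (act x g) tt k' * u (m', k')).
          2: by rewrite pair_bigA; apply: eq_bigr => -[].
        rewrite (bigD1 m) //= [X in _ + X]big1 ?addr0 => [|m' mm'].
          by apply: eq_bigr => k' _; rewrite eqxx mul1r.
        by rewrite big1 // => k' _; rewrite eq_sym (negPf mm') !mul0r.
      under eq_bigr => k' _ do rewrite big_distrl /=.
      rewrite exchange_big big1 // => e' _ /=.
      transitivity (fa (act x g) m e' * \sum_k' Y e' k' * u k').
        by rewrite big_distrr; apply: eq_bigr => k' _ /=; rewrite /Y !mulrA.
      by rewrite Yu0 mulr0.
    have := inj_mx_card injY; rewrite !card_prod !card_ord leqNgt => /negP; apply.
    rewrite ltn_pmul2l; first by rewrite -[ltnLHS]addn0 ltn_add2l; case: i {zi Y Yeq injY} => _ t; exact: leq_trans (ltn_ord t).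
    by apply/card_gt0P; exists i.1.
  case: n => // n; have [nJ|] := ltnP n #|{: J}|; last by move=> nJ; rewrite y_out.
  apply: (ga sa0) => g m; have := slotS g m (Ordinal nJ).
  by rewrite f0 mul0r addr0 y00 mulr0 addr0.
Qed.

End Slack.

Section Frame.
Variables (R : realType) (X : space R) (H : finGroupType) (act : smooth_act X H).
Variables (o kappa : nat).
Hypothesis card_H : #|H| = (o * kappa)%N.
Hypothesis stab_slack : forall x, #|stab act x| = kappa \/ ((o + o) * #|stab act x| <= #|H|)%N.

(** Starts from a frame on the whole maximal stratum; each [slack_glue] keeps the points already
    covered and adds those off the stratum separated by one more moment, where a moment frame of
    rank o + o exists. *)
Lemma frame_all : exists (C : finType) (f : pt X -> C -> C * 'I_o -> R),
  [/\ (0 < #|C|)%N, forall m e, smooth_fun (fun x => f x m e) & forall x, stack_inj act f x].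
Proof.
have [N sepN] := exists_separated act.
suff main n : exists (C : finType) (f : pt X -> C -> C * 'I_o -> R),
  [/\ (0 < #|C|)%N, forall m e, smooth_fun (fun x => f x m e) &
     forall x, #|stab act x| = kappa \/ (exists2 k, (k < n)%N & separated act k x) ->
       stack_inj act f x].
  have [C [f [C0 sf vf]]] := main N; exists C, f; split=> // x.
  by apply: vf; right; exact: sepN.
elim: n => [|n [C [f [C0 sf vf]]]].
  have [C [f [C0 sf vf]]] := frame_max_stratum act card_H.
  by exists C, f; split=> // x [/vf|[]].
exists ('I_#|{: (C * 'I_o) * (C * 'I_(o + o))}|.+1 * C)%type,
  (slack_glue act f (@moment_frame _ _ (o + o) n)); split.
- by rewrite card_prod card_ord muln_gt0 C0.
- by move=> m e; apply: smooth_fun_slack_glue => // r t; exact: smooth_fun_moment_frame.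
move=> x Hx; apply: slack_glue_inj.
case: (stab_slack x) => [sx|sx]; first by left; apply: vf; left.
case: Hx => [sx'|[k]]; first by left; apply: vf; left.
rewrite ltnS leq_eqVlt => /orP[/eqP ->|kn] sepk; last by left; apply: vf; right; exists k.
by right; exact: moment_frame_inj.
Qed.

End Frame.

(** * Trivialisation of multiples of a stably trivial bundle *)

Section Apply.
Variables (R : realType) (I J : finType).

Definition mxapp (M : J -> I -> R) (u : I -> R) (j : J) : R := \sum_i M j i * u i.

Lemma mxapp_lin M k u v : mxapp M (fun i => k * u i + v i) = (fun j => k * mxapp M u j + mxapp M v j).
Proof.
apply/funext => j; rewrite /mxapp big_distrr -big_split; apply: eq_bigr => i _ /=.
by rewrite mulrDr mulrCA.
Qed.

Lemma mxapp0 M : mxapp M (fun=> 0) = fun=> 0.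
Proof. by apply/funext => j; rewrite /mxapp big1 // => i _; rewrite mulr0. Qed.

End Apply.

Section Trivialise.
Variables (R : realType) (X : space R) (Q T : finType).
Variables (a : pt X -> Q -> T -> R) (a' : pt X -> T -> Q -> R).
Hypotheses (sa : forall r i, smooth_fun (fun x => a x r i))
           (sa' : forall i r, smooth_fun (fun x => a' x i r)).
Hypothesis a'aK : forall x y, mxapp (a' x) (mxapp (a x) y) = y.
Hypothesis TTQ : (#|T| + #|T| <= #|Q|)%N.

(** The copies of the ambient space Q: one slot [None], one slot [Some None], and one
    slot for each pair (i, k) of a coordinate of T and a basis vector of Q. *)
Definition slot := option (option (T * Q)).
Local Notation sN := None.
Local Notation sE := (Some None).
Local Notation sP p := (Some (Some p)).
Definition vec := slot -> Q -> R.

(** Fibrewise linear and preserving smooth families over any [pi : Y -> X]. The parameter space is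
    needed because on the sphere bundle the vector varies along with the base point. *)
Definition smooth_op (F : pt X -> vec -> vec) : Prop :=
  (forall x k u w, F x (fun s r => k * u s r + w s r) = fun s r => k * F x u s r + F x w s r) /\
  forall (Y : space R) (pi : pt Y -> pt X) (w : pt Y -> vec),
    (forall i, smooth_fun (fun y => crd i (pi y))) -> (forall s r, smooth_fun (fun y => w y s r)) ->
    forall s r, smooth_fun (fun y => F (pi y) (w y) s r).

Definition automorphism (F F' : pt X -> vec -> vec) : Prop :=
  [/\ smooth_op F, smooth_op F', forall x w, F x (F' x w) = w & forall x w, F' x (F x w) = w].

Definition reach (st st' : pt X -> (slot -> T -> R) -> vec) : Prop :=
  exists F F', automorphism F F' /\ forall x y, F x (st x y) = st' x y.

Lemma smooth_op_id : smooth_op (fun _ w => w).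
Proof. by split=> // Y pi w _ sw s r. Qed.

Lemma smooth_op_comp F G : smooth_op F -> smooth_op G -> smooth_op (fun x w => F x (G x w)).
Proof.
move=> [lF sF] [lG sG]; split=> [x k u w|Y pi w spi sw]; first by rewrite lG lF.
by apply: sF => // s r; exact: sG.
Qed.

Lemma reach_refl st : reach st st.
Proof. by exists (fun _ w => w), (fun _ w => w); split=> //; split=> //; exact: smooth_op_id. Qed.

Lemma reach_trans st1 st2 st3 : reach st1 st2 -> reach st2 st3 -> reach st1 st3.
Proof.
move=> [F [F' [[sF sF' FK F'K] E]]] [G [G' [[sG sG' GK G'K] E']]].
exists (fun x w => G x (F x w)), (fun x w => F' x (G' x w)); split.
  split; try exact: smooth_op_comp.
  - by move=> x w; rewrite FK GK.
  - by move=> x w; rewrite G'K F'K.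
by move=> x y; rewrite E E'.
Qed.

Definition shear (P : pred slot) (L : pt X -> vec -> vec) (k : R) (x : pt X) (w : vec) : vec :=
  fun s r => w s r + (if P s then k * L x w s r else 0).

(** [L] reads only the slots outside [P], which the shear does not change, so subtracting [L] undoes
    adding it. *)
Lemma shear_automorphism P L : smooth_op L ->
  (forall x w w', (forall s, ~~ P s -> w s = w' s) -> L x w = L x w') ->
  automorphism (shear P L 1) (shear P L (-1)).
Proof.
move=> [lL sL] dL.
have sh k : smooth_op (shear P L k).
  split=> [x c u w|Y pi w spi sw s r].
    apply/funext => s; apply/funext => r; rewrite /shear lL.
    by case: (P s); rewrite ?addr0 // !mulrDr; ring.
  rewrite /shear; apply: smooth_fun_add => //.
  case: (P s); last exact: smooth_fun_cst.
  by apply: smooth_fun_mul; [exact: smooth_fun_cst|exact: sL].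
have shK k x w : shear P L (- k) x (shear P L k x w) = w.
  apply/funext => s; apply/funext => r; rewrite {1}/shear.
  rewrite (dL x (shear P L k x w) w) => [|s' Ps']; last first.
    by apply/funext => r'; rewrite /shear (negPf Ps') addr0.
  by rewrite /shear; case: (P s); rewrite ?addr0 //; ring.
split=> // x w; by rewrite -[X in shear P L X _ (shear _ _ _ _ _)](opprK 1) shK.
Qed.

Lemma reach_shear st st' P L : smooth_op L ->
  (forall x w w', (forall s, ~~ P s -> w s = w' s) -> L x w = L x w') ->
  (forall x y s r, shear P L 1 x (st x y) s r = st' x y s r) -> reach st st'.
Proof.
move=> sL dL E; exists (shear P L 1), (shear P L (-1)); split.
  exact: shear_automorphism.
by move=> x y; apply/funext => s; apply/funext => r.
Qed.

(** Two disjoint copies of T among the basis vectors of Q, so that one slot can store two vectors of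
    T as constants. *)
Definition double (b : bool) (i : T) : Q :=
  enum_val (widen_ord TTQ (if b then rshift #|T| (enum_rank i) else lshift #|T| (enum_rank i))).

Lemma double_eq b b' i i' : (double b i == double b' i') = (b == b') && (i == i').
Proof.
rewrite (inj_eq enum_val_inj) -(inj_eq val_inj) /=.
have ti : (enum_rank i < #|T|)%N := ltn_ord _.
have ti' : (enum_rank i' < #|T|)%N := ltn_ord _.
rewrite -[i == i'](inj_eq enum_rank_inj) -[enum_rank i == _](inj_eq val_inj) /=.
case: b; case: b' => /=; rewrite ?eqn_add2l //; apply/negbTE/eqP => e.
  by move: ti'; rewrite -e ltnNge leq_addr.
by move: ti; rewrite e ltnNge leq_addr.
Qed.

Definition put (b : bool) (y : T -> R) (r : Q) : R := mxapp (fun r i => (r == double b i)%:R) y r.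

Lemma put_double b b' y i : put b y (double b' i) = (b == b')%:R * y i.
Proof.
rewrite /put /mxapp (bigD1 i) //= double_eq eqxx andbT [b' == b]eq_sym big1 ?addr0 // => i' ii'.
by rewrite double_eq eq_sym [i == i']eq_sym (negPf ii') andbF mul0r.
Qed.

Definition defect (x : pt X) (u : Q -> R) (k : Q) : R := u k - mxapp (a x) (mxapp (a' x) u) k.

(** Recovers z from the components z_i e_k modulo the image of a: the trace of the
    projection 1 - a a' is #|Q| - #|T|. *)
Definition readz (x : pt X) (w : vec) (i : T) : R :=
  (#|Q| - #|T|)%:R^-1 * \sum_k defect x (w (sP (i, k))) k.

Hypothesis T_gt0 : (0 < #|T|)%N.

Lemma defect_lin x c u v k :
  defect x (fun r => c * u r + v r) k = c * defect x u k + defect x v k.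
Proof. by rewrite /defect !mxapp_lin; ring. Qed.

Lemma defect_a x y k : defect x (mxapp (a x) y) k = 0.
Proof. by rewrite /defect a'aK subrr. Qed.

Lemma sum_defect x : \sum_k defect x (fun r => (k == r)%:R) k = (#|Q| - #|T|)%:R.
Proof.
rewrite sumrB natrB; last by apply: leq_trans TTQ; exact: leq_addr.
congr (_ - _); first by rewrite (eq_bigr (fun=> 1)) ?sumr_const // => k _; rewrite eqxx.
transitivity (\sum_(i : T) \sum_k a' x i k * a x k i).
  rewrite [RHS]exchange_big; apply: eq_bigr => k _; apply: eq_bigr => i _.
  rewrite [RHS]mulrC; congr (_ * _); rewrite /mxapp (bigD1 k) //= eqxx mulr1 big1 ?addr0 // => k' kk'.
  by rewrite eq_sym (negPf kk') mulr0.
rewrite (eq_bigr (fun=> 1)) ?sumr_const // => i _.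
have := congr1 (fun f => f i) (a'aK x (fun i' => (i' == i)%:R)); rewrite eqxx; apply: etrans.
apply: eq_bigr => k _; congr (_ * _).
rewrite /mxapp (bigD1 i) //= eqxx mulr1 big1 ?addr0 // => i' /negPf ->.
by rewrite mulr0.
Qed.

Lemma readz_iota x (w : vec) (y : slot -> T -> R) (z : T -> R) :
  (forall i k, w (sP (i, k)) = fun r => z i * (k == r)%:R + mxapp (a x) (y (sP (i, k))) r) ->
  readz x w = z.
Proof.
move=> wE; apply/funext => i; rewrite /readz.
under eq_bigr => k _ do rewrite wE defect_lin defect_a addr0.
rewrite -big_distrr /= sum_defect mulrC mulfK // pnatr_eq0 -lt0n subn_gt0.
by apply: leq_trans TTQ; rewrite -[ltnLHS]addn0 ltn_add2l.
Qed.

Local Notation state := (pt X -> (slot -> T -> R) -> vec).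

(** The automorphisms taking the frame a, repeated in every slot, to a constant frame:
    spread the vector of slot [None] over the slots (i, k) modulo the image of a,
    move the one of slot [Some None] to the free slot [None] as a constant, bring back
    the first one next to it, and use the free slot [Some None] to make the remaining
    ones constant one after the other. *)
Definition st_frame : state := fun x y s => mxapp (a x) (y s).
Definition st_spread : state := fun x y s r =>
  if s is sP p then y sN p.1 * (p.2 == r)%:R + mxapp (a x) (y s) r else mxapp (a x) (y s) r.
Definition st_None_freed : state := fun x y s r => if s is sN then 0 else st_spread x y s r.
Definition st_E_moved : state := fun x y s r => if s is sN then put false (y sE) r else st_spread x y s r.
Definition st_E_freed : state := fun x y s r => if s is sE then 0 else st_E_moved x y s r.
Definition st_both_moved : state := fun x y s r =>
  if s is sN then put false (y sE) r + put true (y sN) r else st_E_freed x y s r.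
Definition st_loop (l : seq (T * Q)) : state := fun x y s r =>
  match s with
  | sN => put false (y sE) r + put true (y sN) r
  | sE => 0
  | sP p => if p \in l then put false (y s) r else mxapp (a x) (y s) r
  end.
Definition st_const : state := fun x y s r =>
  match s with
  | sN => put false (y sE) r + put true (y sN) r
  | sE => 0
  | sP p => put false (y s) r
  end.

Lemma smooth_fun_app (Y : space R) (I J : finType) (M : pt Y -> J -> I -> R) (u : pt Y -> I -> R) j :
  (forall j i, smooth_fun (fun y => M y j i)) -> (forall i, smooth_fun (fun y => u y i)) ->
  smooth_fun (fun y => mxapp (M y) (u y) j).
Proof. by move=> sM su; apply: smooth_fun_sum => i; apply: smooth_fun_mul. Qed.

Lemma put_lin b k u v : put b (fun i => k * u i + v i) = fun r => k * put b u r + put b v r.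
Proof. exact: mxapp_lin. Qed.

Lemma readz_lin x k u w :
  readz x (fun s r => k * u s r + w s r) = fun i => k * readz x u i + readz x w i.
Proof.
apply/funext => i; rewrite /readz.
under eq_bigr => k' _ do rewrite defect_lin.
by rewrite big_split -big_distrr /= mulrDr mulrCA.
Qed.

Section Pullback.
Variables (Y : space R) (pi : pt Y -> pt X).
Hypothesis spi : forall i, smooth_fun (fun y => crd i (pi y)).

Lemma smooth_fun_app_a (u : pt Y -> T -> R) r :
  (forall i, smooth_fun (fun y => u y i)) -> smooth_fun (fun y => mxapp (a (pi y)) (u y) r).
Proof. by move=> su; apply: smooth_fun_app => // j i; exact: (smooth_fun_comp spi (sa j i)). Qed.

Lemma smooth_fun_app_a' (u : pt Y -> Q -> R) i :
  (forall r, smooth_fun (fun y => u y r)) -> smooth_fun (fun y => mxapp (a' (pi y)) (u y) i).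
Proof. by move=> su; apply: smooth_fun_app => // j k; exact: (smooth_fun_comp spi (sa' j k)). Qed.

Lemma smooth_fun_put b (u : pt Y -> T -> R) r :
  (forall i, smooth_fun (fun y => u y i)) -> smooth_fun (fun y => put b (u y) r).
Proof. by move=> su; apply: smooth_fun_app => // j k; exact: smooth_fun_cst. Qed.

Lemma smooth_fun_readz (w : pt Y -> vec) i :
  (forall s r, smooth_fun (fun y => w y s r)) -> smooth_fun (fun y => readz (pi y) (w y) i).
Proof.
move=> sw; apply: smooth_fun_mul; first exact: smooth_fun_cst.
apply: smooth_fun_sum => k; apply: smooth_fun_sub => //.
by apply: smooth_fun_app_a => j; exact: smooth_fun_app_a'.
Qed.

End Pullback.

Lemma op_put b (s0 : slot) : smooth_op (fun x w _ => put b (mxapp (a' x) (w s0))).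
Proof.
split=> [x k u w|Y pi w spi sw s r]; first by rewrite mxapp_lin put_lin.
by apply: smooth_fun_put => i; exact: smooth_fun_app_a'.
Qed.

Lemma op_iota (s0 : slot) : smooth_op (fun x w s r =>
  if s is sP p then mxapp (a' x) (w s0) p.1 * (p.2 == r)%:R else 0).
Proof.
split=> [x k u w|Y pi w spi sw [[p|]|] r]; try exact: smooth_fun_cst.
  apply/funext => -[[p|]|]; apply/funext => r; rewrite ?mxapp_lin; ring.
by apply: smooth_fun_mul; [exact: smooth_fun_app_a'|exact: smooth_fun_cst].
Qed.

Lemma op_iota_kap b (s0 : slot) : smooth_op (fun x w s r =>
  if s is sP p then - (w s0 (double b p.1) * (p.2 == r)%:R) else 0).
Proof.
split=> [x k u w|Y pi w spi sw [[p|]|] r]; try exact: smooth_fun_cst.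
  apply/funext => -[[p|]|]; apply/funext => r; ring.
by apply: smooth_fun_opp; apply: smooth_fun_mul; [exact: sw|exact: smooth_fun_cst].
Qed.

Lemma op_a_readz : smooth_op (fun x w _ r => - mxapp (a x) (readz x w) r).
Proof.
split=> [x k u w|Y pi w spi sw s r].
  by rewrite readz_lin mxapp_lin; apply/funext => _; apply/funext => r; ring.
by apply: smooth_fun_opp; apply: smooth_fun_app_a => // i; exact: smooth_fun_readz.
Qed.

Lemma op_put_readz b : smooth_op (fun x w _ => put b (readz x w)).
Proof.
split=> [x k u w|Y pi w spi sw s r]; first by rewrite readz_lin put_lin.
by apply: smooth_fun_put => i; exact: smooth_fun_readz.
Qed.

Lemma op_a_kap b (s0 : slot) : smooth_op (fun x w _ r => - mxapp (a x) (fun i => w s0 (double b i)) r).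
Proof.
split=> [x k u w|Y pi w spi sw s r].
  by rewrite (mxapp_lin _ _ (fun i => u s0 (double b i))); apply/funext => _; apply/funext => r; ring.
by apply: smooth_fun_opp; apply: smooth_fun_app_a.
Qed.

Lemma op_put_kap b c (s0 : slot) : smooth_op (fun x w _ => put b (fun i => w s0 (double c i))).
Proof.
split=> [x k u w|Y pi w spi sw s r]; first by rewrite (put_lin _ _ (fun i => u s0 (double c i))).
exact: smooth_fun_put.
Qed.

Lemma op_opp F : smooth_op F -> smooth_op (fun x w s r => - F x w s r).
Proof.
move=> [lF sF]; split=> [x k u w|Y pi w spi sw s r].
  by apply/funext => s; apply/funext => r; rewrite lF; ring.
by apply: smooth_fun_opp; exact: sF.
Qed.

(** The empty slot [Some None] serves as a buffer: store the vector of slot p there in constant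
    form, use it to clear slot p, write the constant form into slot p, and empty the buffer. *)
Lemma reach_loop p l : p \notin l -> reach (st_loop l) (st_loop (p :: l)).
Proof.
move=> pl.
pose t1 : state := fun x y s r => if s is sE then put false (y (sP p)) r else st_loop l x y s r.
pose t2 : state := fun x y s r => if s == sP p then 0 else t1 x y s r.
pose t3 : state := fun x y s r => if s == sP p then put false (y (sP p)) r else t1 x y s r.
have st_p x y : st_loop l x y (sP p) = mxapp (a x) (y (sP p)).
  by apply/funext => r; rewrite /st_loop (negPf pl).
have spE (s : slot) : s == sP p -> s = sP p by move/eqP.
apply: (@reach_trans _ t1).
  apply: (reach_shear (P := pred1 sE) (op_put false (sP p))) => [x w w' E|x y [[q|]|] r].
  - by rewrite E.
  - by rewrite /shear /= addr0.
  - by rewrite /shear /= st_p a'aK mul1r add0r.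
  - by rewrite /shear /= addr0.
apply: (@reach_trans _ t2).
  apply: (reach_shear (P := pred1 (sP p)) (op_a_kap false sE)) => [x w w' E|x y s r].
  - by rewrite E.
  rewrite /shear /t2 /=; case: ifP => [/spE ->|_]; last by rewrite addr0.
  rewrite /= (negPf pl) mul1r (_ : (fun i => _) = y (sP p)) ?subrr //.
  by apply/funext => i; rewrite put_double eqxx mul1r.
apply: (@reach_trans _ t3).
  apply: (reach_shear (P := pred1 (sP p)) (op_put_kap false false sE)) => [x w w' E|x y s r].
  - by rewrite E.
  rewrite /shear /t3 /t2 /=; case: ifP => [_|_]; last by rewrite addr0.
  rewrite add0r mul1r (_ : (fun i => _) = y (sP p)) //.
  by apply/funext => i; rewrite put_double eqxx mul1r.
apply: (reach_shear (P := pred1 sE) (op_opp (op_put_kap false false (sP p)))) => [x w w' E|x y s r].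
  by rewrite E.
rewrite /shear /t3 /= eqxx; case: s => [[q|]|] /=.
- rewrite addr0 inE (inj_eq (@Some_inj _)) (inj_eq (@Some_inj _)).
  by case: eqP => [->|].
- rewrite mul1r (_ : (fun i => _) = y (sP p)) ?subrr //.
  by apply/funext => i; rewrite put_double eqxx mul1r.
- by rewrite addr0.
Qed.

Lemma reach_const : reach st_frame st_const.
Proof.
apply: (@reach_trans _ st_spread).
  apply: (reach_shear (P := fun s => if s is sP _ then true else false) (op_iota sN)).
    by move=> x w w' E; rewrite E.
  by move=> x y [[p|]|] r; rewrite /shear /= ?addr0 // a'aK mul1r addrC.
have spread x y (w : vec) : (forall p, w (sP p) = st_spread x y (sP p)) -> readz x w = y sN.
  by move=> wE; apply: (@readz_iota _ _ y) => i k; rewrite wE.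
(* [readz] ignores slot [None], so it supplies the shears that first clear this slot and later write
   a constant into it. *)
have readzE x w w' : (forall s, s != sN -> w s = w' s) -> readz x w = readz x w'.
  by move=> E; apply/funext => i; congr (_ * _); apply: eq_bigr => k _; rewrite E.
apply: (@reach_trans _ st_None_freed).
  apply: (reach_shear (P := pred1 sN) op_a_readz).
    by move=> x w w' E; rewrite (readzE x w w').
  by move=> x y [[p|]|] r; rewrite /shear /= ?addr0 // (spread _ y) // mul1r subrr.
apply: (@reach_trans _ st_E_moved).
  apply: (reach_shear (P := pred1 sN) (op_put false sE)).
    by move=> x w w' E; rewrite E.
  by move=> x y [[p|]|] r; rewrite /shear /= ?addr0 // a'aK mul1r add0r.
apply: (@reach_trans _ st_E_freed).
  apply: (reach_shear (P := pred1 sE) (op_a_kap false sN)).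
    by move=> x w w' E; rewrite E.
  move=> x y [[p|]|] r; rewrite /shear /= ?addr0 // mul1r.
  rewrite (_ : (fun i => _) = y sE) ?subrr //.
  by apply/funext => i; rewrite put_double eqxx mul1r.
apply: (@reach_trans _ st_both_moved).
  apply: (reach_shear (P := pred1 sN) (op_put_readz true)).
    by move=> x w w' E; rewrite (readzE x w w').
  by move=> x y [[p|]|] r; rewrite /shear /= ?addr0 // (spread _ y) // mul1r.
(* The spread vector is now stored as a constant in slot [None], from where it is read in order to
   subtract the spread terms. *)
apply: (@reach_trans _ (st_loop [::])).
  apply: (reach_shear (P := fun s => if s is sP _ then true else false) (op_iota_kap true sN)).
    by move=> x w w' E; rewrite E.
  move=> x y [[p|]|] r; rewrite /shear /= ?addr0 // mul1r !put_double /= mul0r add0r mul1r.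
  by ring.
have main (l : seq (T * Q)) : uniq l -> reach (st_loop [::]) (st_loop l).
  elim: l => [_|p l IH /andP[pl ul]]; first exact: reach_refl.
  by apply: reach_trans (IH ul) _; exact: reach_loop.
have [F [F' [FF' E]]] := main _ (index_enum_uniq (T * Q)%type).
exists F, F'; split=> // x y; rewrite E.
by apply/funext => -[[p|]|]; apply/funext => r //=; rewrite mem_index_enum.
Qed.

End Trivialise.

(** * Adding a sphere *)

Section Spheres.
Variable R : realType.

Definition sphere_pt (d : nat) : Type := {v : {ffun 'I_d.+1 -> R} | \sum_i v i ^+ 2 == 1}.

Definition add_sphere_crd (X : space R) (d : nat) (i : 'I_d.+1 + idx X) (y : sphere_pt d * pt X) : R :=
  match i with inl k => val y.1 k | inr j => crd j y.2 end.

Lemma add_sphere_crd_inj X d (y z : sphere_pt d * pt X) :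
  (forall i, add_sphere_crd i y = add_sphere_crd i z) -> y = z.
Proof.
case: y z => [v x] [w x'] E; congr (_, _).
  by apply/val_inj/ffunP => k; exact: (E (inl k)).
by apply: crd_inj => j; exact: (E (inr j)).
Qed.

Definition add_sphere (X : space R) (d : nat) : space R :=
  @Space R _ ('I_d.+1 + idx X)%type (@add_sphere_crd X d) (@add_sphere_crd_inj X d).

Definition enorm (d : nat) (u : 'I_d.+1 -> R) : R := Num.sqrt (\sum_i u i ^+ 2).

Lemma enorm_gt0 d (u : 'I_d.+1 -> R) i : u i != 0 -> 0 < enorm u.
Proof.
move=> ui; rewrite sqrtr_gt0 lt_def sumr_ge0 => [|j _]; last exact: sqr_ge0.
rewrite andbT psumr_neq0 => [|j _]; last exact: sqr_ge0.
apply/hasP; exists i; rewrite ?mem_index_enum //=.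
by rewrite lt_def sqr_ge0 sqrf_eq0 ui.
Qed.

Lemma enorm_scale d (u : 'I_d.+1 -> R) c : 0 <= c -> enorm (fun i => c * u i) = c * enorm u.
Proof.
move=> c0; rewrite /enorm; under eq_bigr => i _ do rewrite exprMn.
by rewrite -big_distrr /= sqrtrM ?sqr_ge0 // sqrtr_sqr ger0_norm.
Qed.

Lemma enorm_sphere_pt d (v : sphere_pt d) : enorm (val v) = 1.
Proof. by rewrite /enorm (eqP (valP v)) sqrtr1. Qed.

Lemma normalize_subproof d (u : 'I_d.+1 -> R) : enorm u != 0 ->
  \sum_i [ffun i => u i / enorm u] i ^+ 2 == 1.
Proof.
move=> u0; under eq_bigr => i _ do rewrite ffunE exprMn.
rewrite -big_distrl /= -[X in X * _](@sqr_sqrtr R).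
  by rewrite -/(enorm u) -exprMn divff // expr1n.
by apply: sumr_ge0 => i _; exact: sqr_ge0.
Qed.

Definition normalize d (u : 'I_d.+1 -> R) (u0 : enorm u != 0) : sphere_pt d :=
  exist (fun v : {ffun 'I_d.+1 -> R} => \sum_i v i ^+ 2 == 1) _ (normalize_subproof u0).

Lemma sphere_pt_neq0 d (v : sphere_pt d) : exists i, val v i != 0.
Proof.
apply: contrapT => v0; have /eqP := valP v; rewrite big1 => [/esym/eqP|i _].
  by rewrite oner_eq0.
apply/eqP; rewrite sqrf_eq0; apply: contrapT => /negP vi.
by apply: v0; exists i.
Qed.

End Spheres.

Section Stage.
Variables (R : realType) (X : space R) (H : finGroupType) (act : smooth_act X H).
Variables (Q T : finType) (a : pt X -> Q -> T -> R) (a' : pt X -> T -> Q -> R).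
Hypotheses (sa : forall r i, smooth_fun (fun x => a x r i))
           (sa' : forall i r, smooth_fun (fun x => a' x i r)).
Hypothesis a'aK : forall x y, mxapp (a' x) (mxapp (a x) y) = y.
Hypothesis TTQ : (#|T| + #|T| <= #|Q|)%N.
Hypothesis T_gt0 : (0 < #|T|)%N.
Variable perm : H -> Q -> Q.
Hypothesis perm1 : forall r, perm 1%g r = r.
Hypothesis permM : forall g h r, perm (g * h)%g r = perm g (perm h r).
Hypothesis a'_equiv : forall x h u,
  mxapp (a' x) u = (fun=> 0) -> mxapp (a' (act x h)) (u \o perm h) = (fun=> 0).

Local Notation slot := (slot Q T).
Local Notation vec := (vec R Q T).
Local Notation double := (double TTQ).
Local Notation put := (put TTQ).

(** The coordinates not occupied by the constant frame: they trivialise its complement, and the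
    sphere to be added lives in them. *)
Definition free_crd (sr : slot * Q) : bool :=
  match sr.1 with
  | None => [forall i, (sr.2 != double true i) && (sr.2 != double false i)]
  | Some None => true
  | Some (Some _) => [forall i, sr.2 != double false i]
  end.

Local Notation N := #|[set sr | free_crd sr]|.

(** The slot [Some None] is entirely free and contributes at least two coordinates, so the new
    sphere has positive dimension. *)
Lemma N_gt1 : (1 < N)%N.
Proof.
apply: (@leq_trans #|Q|).
  apply: leq_trans TTQ; rewrite addnn -muln2.
  by case: #|T| T_gt0.
rewrite -(card_imset predT (_ : injective (fun r : Q => ((Some None : slot), r)))); last first.
  by move=> r r' [].
by apply/subset_leq_card/fintype.subsetP => _ /imsetP[r _ ->]; rewrite inE.
Qed.

Local Notation d := N.-1.

Let dN : d.+1 = N. Proof. exact: ltn_predK N_gt1. Qed.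

Definition nu (k : 'I_d.+1) : slot * Q := enum_val (cast_ord dN k).

Lemma nu_inj : injective nu.
Proof. by move=> k k' /enum_val_inj/cast_ord_inj. Qed.

Lemma nu_free k : free_crd (nu k).
Proof. by have := enum_valP (cast_ord dN k); rewrite inE. Qed.

Lemma nu_surj sr : free_crd sr -> exists k, nu k = sr.
Proof.
move=> fsr; have srN : sr \in [set sr | free_crd sr] by rewrite inE.
exists (cast_ord (esym dN) (enum_rank_in srN sr)).
by rewrite /nu cast_ordKV enum_rankK_in.
Qed.

Definition emb (v : 'I_d.+1 -> R) : vec := fun s r => \sum_k (nu k == (s, r))%:R * v k.
Definition prj (w : vec) (k : 'I_d.+1) : R := w (nu k).1 (nu k).2.

Lemma emb_nu v k : emb v (nu k).1 (nu k).2 = v k.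
Proof.
rewrite /emb -surjective_pairing (bigD1 k) //= eqxx mul1r big1 ?addr0 // => k' kk'.
by rewrite (inj_eq nu_inj) (negPf kk') mul0r.
Qed.

Lemma emb_out v s r : ~~ free_crd (s, r) -> emb v s r = 0.
Proof.
move=> fsr; rewrite /emb big1 // => k _.
by case: eqP => [E|]; rewrite ?mul0r //; move: fsr; rewrite -E nu_free.
Qed.

Definition coef (w : vec) (s : slot) (i : T) : R :=
  match s with
  | None => w None (double true i)
  | Some None => w None (double false i)
  | Some (Some _) => w s (double false i)
  end.

Local Notation const_vec x := (@st_const _ X Q T TTQ x).

Lemma put_out b y r : [forall i, r != double b i] -> put b y r = 0 :> R.
Proof.
move=> /forallP rk; rewrite /put /mxapp big1 // => i _.
by rewrite (negPf (rk i)) mul0r.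
Qed.

Lemma const_vec_free x y s r : free_crd (s, r) -> const_vec x y s r = 0.
Proof.
case: s => [[p|]|] //= /forallP rk; rewrite ?put_out //.
- by apply/forallP => i; exact: rk.
- rewrite addr0 //.
- by apply/forallP => i; case/andP: (rk i).
- by apply/forallP => i; case/andP: (rk i).
Qed.

Lemma decompose x w s r : w s r = emb (prj w) s r + const_vec x (coef w) s r.
Proof.
case: (boolP (free_crd (s, r))) => [fsr|fsr].
  rewrite const_vec_free // addr0; have [k kE] := nu_surj fsr.
  by have := emb_nu (prj w) k; rewrite /prj kE.
rewrite emb_out // add0r; case: s fsr => [[p|]|] //= /forallPn[i] /=.
  by rewrite negbK => /eqP ->; rewrite put_double eqxx mul1r.
by rewrite negb_and !negbK => /orP[] /eqP ->; rewrite !put_double eqxx mul1r mul0r ?addr0 ?add0r.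
Qed.

Lemma prj_const x y : prj (const_vec x y) = fun=> 0.
Proof.
apply/funext => k; rewrite /prj const_vec_free //.
by have := nu_free k; case: (nu k).
Qed.

Lemma prj_emb v : prj (emb v) = v.
Proof. by apply/funext => k; exact: emb_nu. Qed.

Lemma linear_op0 (F : pt X -> vec -> vec) x : smooth_op F -> F x (fun _ _ => 0) = (fun _ _ => 0) :> vec.
Proof.
move=> [lF _]; have := lF x 1 (fun _ _ => 0) (fun _ _ => 0).
rewrite (_ : (fun _ _ => 1 * 0 + 0) = fun _ _ => 0 :> R) => [E|]; last first.
  by apply/funext => s; apply/funext => r; ring.
apply/funext => s; apply/funext => r; have := congr1 (fun f => f s r) E.
by move/eqP; rewrite mul1r -subr_eq0 opprD addrA subrr add0r oppr_eq0 => /eqP.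
Qed.

Lemma op_scale (F : pt X -> vec -> vec) x c w : smooth_op F -> F x (fun s r => c * w s r) = (fun s r => c * F x w s r).
Proof.
move=> sF; have := sF.1 x c w (fun _ _ => 0); rewrite (linear_op0 _ sF).
rewrite (_ : (fun _ _ => _) = fun s r => c * w s r); last first.
  by apply/funext => s; apply/funext => r; rewrite addr0.
by move=> ->; apply/funext => s; apply/funext => r; rewrite addr0.
Qed.

Variables (F F' : pt X -> vec -> vec).
Hypotheses (sF : smooth_op F) (sF' : smooth_op F')
  (FK : forall x w, F x (F' x w) = w) (F'K : forall x w, F' x (F x w) = w)
  (F_const : forall x y, F x (@st_frame _ _ _ _ a x y) = const_vec x y).

Definition ker_vec (x : pt X) (w : vec) : Prop := forall s, mxapp (a' x) (w s) = (fun=> 0).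

(** Inverse of the trivialisation [prj \o F] on the kernel of a'. Projecting onto the kernel along
    the image of a leaves the coordinates alone, since [F] takes that image to the constant frame,
    which [prj] kills. *)
Definition unpr (x : pt X) (v : 'I_d.+1 -> R) : vec :=
  fun s r => F' x (emb v) s r - mxapp (a x) (mxapp (a' x) (F' x (emb v) s)) r.

Lemma mxapp_sub (I J : finType) (M : J -> I -> R) u v :
  mxapp M (fun i => u i - v i) = fun j => mxapp M u j - mxapp M v j.
Proof.
rewrite (_ : (fun i => _) = fun i => (-1) * v i + u i); last by apply/funext => i; ring.
by rewrite mxapp_lin; apply/funext => j; ring.
Qed.

Lemma ker_unpr x v : ker_vec x (unpr x v).
Proof.
by move=> s; rewrite /unpr mxapp_sub a'aK; apply/funext => i; rewrite subrr.
Qed.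

Lemma F_unpr x v : prj (F x (unpr x v)) = v.
Proof.
set y := fun s => mxapp (a' x) (F' x (emb v) s).
have -> : unpr x v = fun s r => (-1) * st_frame a x y s r + F' x (emb v) s r.
  by apply/funext => s; apply/funext => r; rewrite /unpr /st_frame /y; ring.
rewrite sF.1 FK F_const; apply/funext => k.
have := congr1 (fun f => f k) (prj_const x y); have := congr1 (fun f => f k) (prj_emb v).
by rewrite /prj => -> ->; ring.
Qed.

Lemma unpr_F x w : ker_vec x w -> unpr x (prj (F x w)) = w.
Proof.
move=> kw; set y := coef (F x w).
have E : F' x (emb (prj (F x w))) = fun s r => (-1) * st_frame a x y s r + w s r.
  rewrite -[w in RHS](F'K x) -[st_frame a x y in RHS](F'K x) F_const -sF'.1.
  congr (F' x _); apply/funext => s; apply/funext => r.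
  by rewrite [in RHS](decompose x (F x w)); ring.
apply/funext => s; apply/funext => r; rewrite /unpr E.
rewrite (mxapp_lin _ _ (st_frame a x y s)) kw /st_frame a'aK.
rewrite (_ : (fun j => _) = fun j => (-1) * y s j + 0); last by apply/funext => j; ring.
rewrite mxapp_lin; have -> : mxapp (a x) (fun=> 0) = (fun=> 0) by exact: mxapp0.
ring.
Qed.

Definition translate (h : H) (w : vec) : vec := fun s r => w s (perm h r).

Lemma ker_translate x h w : ker_vec x w -> ker_vec (act x h) (translate h w).
Proof. by move=> kw s; exact: a'_equiv. Qed.

(** The trivialisation [prj \o F] of the kernel bundle of a' carries the action of H on
    it to a cocycle with values in linear maps of R^(d+1). *)
Definition cocycle (x : pt X) (h : H) (v : 'I_d.+1 -> R) : 'I_d.+1 -> R :=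
  prj (F (act x h) (translate h (unpr x v))).

Lemma unpr_cocycle x h v : unpr (act x h) (cocycle x h v) = translate h (unpr x v).
Proof. by apply: unpr_F; apply: ker_translate; exact: ker_unpr. Qed.

Lemma cocycle1 x v : cocycle x 1%g v = v.
Proof.
rewrite /cocycle sact1 (_ : translate _ _ = unpr x v) ?F_unpr //.
by apply/funext => s; apply/funext => r; rewrite /translate perm1.
Qed.

Lemma cocycleM x g h v : cocycle x (g * h)%g v = cocycle (act x g) h (cocycle x g v).
Proof.
rewrite {1 2}/cocycle unpr_cocycle sactM; congr (prj (F _ _)).
by apply/funext => s; apply/funext => r; rewrite /translate permM.
Qed.

Lemma unpr_scale x c v : unpr x (fun k => c * v k) = fun s r => c * unpr x v s r.
Proof.
have E : F' x (emb (fun k => c * v k)) = fun s r => c * F' x (emb v) s r.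
  rewrite -op_scale //; congr (F' x _); apply/funext => s; apply/funext => r.
  by rewrite /emb big_distrr; apply: eq_bigr => k _ /=; rewrite mulrCA.
have app_scale (I J : finType) (M : J -> I -> R) u :
    mxapp M (fun i => c * u i) = fun j => c * mxapp M u j.
  by apply/funext => j; rewrite /mxapp big_distrr; apply: eq_bigr => i _ /=; rewrite mulrCA.
by apply/funext => s; apply/funext => r; rewrite /unpr E !app_scale; ring.
Qed.

Lemma cocycle_scale x h c v : cocycle x h (fun k => c * v k) = fun k => c * cocycle x h v k.
Proof.
rewrite /cocycle unpr_scale (_ : translate h _ = fun s r => c * translate h (unpr x v) s r) //.
by rewrite op_scale.
Qed.

(** By the cocycle identity h^-1 brings the vector back, so h cannot send it to zero. *)
Lemma cocycle_neq0 x h (v : 'I_d.+1 -> R) k : v k != 0 -> enorm (cocycle x h v) != 0.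
Proof.
move=> vk; suff [k' k'0] : exists k', cocycle x h v k' != 0 by exact/lt0r_neq0/enorm_gt0/k'0.
apply: contrapT => c0.
have c0' : cocycle x h v = fun k => 0 * v k.
  apply/funext => k'; rewrite mul0r; apply/eqP/negPn/negP => k'0.
  by apply: c0; exists k'.
have := cocycleM x h h^-1%g v; rewrite mulgV cocycle1 c0' cocycle_scale.
by move=> /(congr1 (fun f => f k)) /eqP; rewrite mul0r (negPf vk).
Qed.

Lemma cocycle_sph x h (v : sphere_pt R d) : enorm (cocycle x h (val v)) != 0.
Proof. by have [k] := sphere_pt_neq0 v; exact: cocycle_neq0. Qed.

Definition act_sph (y : pt (add_sphere X d)) (h : H) : pt (add_sphere X d) :=
  (normalize (cocycle_sph y.2 h y.1), act y.2 h).

Lemma act_sphE y h k : val (act_sph y h).1 k = cocycle y.2 h (val y.1) k / enorm (cocycle y.2 h (val y.1)).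
Proof. by rewrite /= ffunE. Qed.

Lemma act_sph1 y : act_sph y 1%g = y.
Proof.
case: y => v x; congr (_, _); last exact: sact1.
by apply/val_inj/ffunP => k; rewrite ffunE cocycle1 enorm_sphere_pt divr1.
Qed.

Lemma act_sphM y g h : act_sph y (g * h)%g = act_sph (act_sph y g) h.
Proof.
case: y => v x; congr (_, _); last exact: sactM.
apply/val_inj/ffunP => k; rewrite !act_sphE [(v, x).2]/= [(v, x).1]/=.
set c := enorm (cocycle x g (val v)).
have cgt0 : 0 < c^-1 by rewrite invr_gt0 lt_def cocycle_sph sqrtr_ge0.
have E : val (act_sph (v, x) g).1 = (fun k => c^-1 * cocycle x g (val v) k) :> ('I_d.+1 -> R).
  by apply/funext => k'; rewrite act_sphE mulrC.
rewrite E cocycle_scale (enorm_scale _ (ltW cgt0)) cocycleM.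
rewrite invfM mulrACA divff ?mul1r //; exact: lt0r_neq0.
Qed.

Lemma smooth_fun_act_sph h i : smooth_fun (fun y => crd i (act_sph y h)).
Proof.
have spi : forall i, smooth_fun (fun y : pt (add_sphere X d) => crd i y.2).
  by move=> j; exact: (@smooth_fun_crd _ (add_sphere X d) (inr j)).
case: i => [k|i]; last first.
  by apply: (smooth_fun_comp spi (smooth_fun_sact act h i)).
have s_emb s r : smooth_fun (fun y : pt (add_sphere X d) => emb (val y.1) s r).
  apply: smooth_fun_sum => k'; apply: smooth_fun_mul; first exact: smooth_fun_cst.
  exact: (@smooth_fun_crd _ (add_sphere X d) (inl k')).
have s_unpr s r : smooth_fun (fun y : pt (add_sphere X d) => unpr y.2 (val y.1) s r).
  have sF'e s' r' : smooth_fun (fun y : pt (add_sphere X d) => F' y.2 (emb (val y.1)) s' r').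
    exact: sF'.2.
  apply: smooth_fun_sub => //; apply: smooth_fun_app => [j i|i].
    exact: (smooth_fun_comp spi (sa j i)).
  by apply: smooth_fun_app => // j i'; exact: (smooth_fun_comp spi (sa' j i')).
have s_coc k' : smooth_fun (fun y : pt (add_sphere X d) => cocycle y.2 h (val y.1) k').
  apply: (sF.2 _ (fun y : pt (add_sphere X d) => act y.2 h) (fun y => translate h (unpr y.2 (val y.1)))) => [j|s' r'].
    exact: (smooth_fun_comp spi (smooth_fun_sact act h j)).
  exact: s_unpr.
apply: (eq_smooth_fun (f := fun y : pt (add_sphere X d) =>
    cocycle y.2 h (val y.1) k / enorm (cocycle y.2 h (val y.1)))) => [y|].
  by rewrite -act_sphE.
apply: smooth_fun_div => // [|y]; last exact: cocycle_sph.
apply: smooth_fun_sqrt; first by apply: smooth_fun_sum => k'; apply: smooth_fun_exp.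
by move=> y; rewrite -sqrtr_gt0 -/(enorm _) lt_def cocycle_sph sqrtr_ge0.
Qed.

Definition stage_act : smooth_act (add_sphere X d) H :=
  SmoothAct act_sph1 act_sphM smooth_fun_act_sph.

(** Because of the normalisation, fixing a point of the sphere only says that h scales its vector by
    some c > 0. As h has finite order, a power of c equals 1, hence c = 1 and the vector itself is
    fixed. *)
Lemma stage_fixed (y : pt (add_sphere X d)) : exists u : Q -> R,
  [/\ exists r, u r != 0, mxapp (a' y.2) u = (fun=> 0) &
     forall h, stage_act y h = y -> act y.2 h = y.2 /\ forall r, u (perm h r) = u r].
Proof.
case: y => v x; set w := unpr x (val v).
have [k vk] := sphere_pt_neq0 v.
have [s [r wsr]] : exists s r, w s r != 0.
  apply: contrapT => w0; case/eqP: vk.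
  have -> : val v k = prj (F x w) k by rewrite F_unpr.
  rewrite (_ : w = fun _ _ => 0) ?linear_op0 //.
  apply/funext => s; apply/funext => r; apply/eqP/negPn/negP => wsr.
  by apply: w0; exists s, r.
exists (w s); split; [by exists r | exact: ker_unpr |] => h vxh.
have xh : act x h = x by have := congr1 snd vxh.
split=> // r'.
set c := enorm (cocycle x h (val v)).
have cgt0 : 0 < c by rewrite lt_def cocycle_sph sqrtr_ge0.
have cocE : cocycle x h (val v) = fun k => c * val v k.
  apply/funext => k'; have : val (stage_act (v, x) h).1 k' = val v k' by rewrite vxh.
  by rewrite act_sphE /= -/c => <-; rewrite mulrCA divff ?mulr1 // lt0r_neq0.
have mw : translate h w = fun s r => c * w s r.
  by rewrite -unpr_scale -cocE /w -unpr_cocycle xh.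
have mwX n : translate (h ^+ n)%g w = fun s r => c ^+ n * w s r.
  elim: n => [|n IH]; apply/funext => s'; apply/funext => r0.
    by rewrite /translate expg0 perm1 expr0 mul1r.
  rewrite expgSr exprSr -mulrA /translate permM.
  have := congr1 (fun f => f s' (perm h r0)) IH; rewrite /translate => ->.
  by congr (_ * _); exact: (congr1 (fun f => f s' r0) mw).
have c1 : c = 1.
  have := congr1 (fun f => f s r) (mwX #[h]%g); rewrite expg_order /translate perm1.
  move=> /esym/eqP; rewrite -subr_eq0 -{2}[w s r]mul1r -mulrBl mulf_eq0 (negPf wsr) orbF.
  by rewrite subr_eq0 pexpr_eq1 ?order_gt0 // ?ltW // => /eqP.
by have := congr1 (fun f => f s r') mw; rewrite c1 mul1r.
Qed.

End Stage.

Lemma sphere_stage (R : realType) (X : space R) (H : finGroupType) (act : smooth_act X H)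
    (Q T : finType) (a : pt X -> Q -> T -> R) (a' : pt X -> T -> Q -> R) (perm : H -> Q -> Q) :
  (forall r i, smooth_fun (fun x => a x r i)) -> (forall i r, smooth_fun (fun x => a' x i r)) ->
  (forall x y, mxapp (a' x) (mxapp (a x) y) = y) ->
  (#|T| + #|T| <= #|Q|)%N -> (0 < #|T|)%N ->
  (forall r, perm 1%g r = r) ->
  (forall g h r, perm (g * h)%g r = perm g (perm h r)) ->
  (forall x h u, mxapp (a' x) u = (fun=> 0) -> mxapp (a' (act x h)) (u \o perm h) = (fun=> 0)) ->
  exists d (act' : smooth_act (add_sphere X d) H), (0 < d)%N /\
  forall y : pt (add_sphere X d), exists u : Q -> R,
    [/\ exists r, u r != 0, mxapp (a' y.2) u = (fun=> 0) &
     forall h, act' y h = y -> act y.2 h = y.2 /\ forall r, u (perm h r) = u r].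
Proof.
move=> sa sa' a'aK TTQ T_gt0 perm1 permM a'_equiv.
have [F [F' [[sF sF' FK F'K] FE]]] := reach_const sa sa' a'aK TTQ T_gt0.
exists _, (stage_act sa sa' a'aK T_gt0 perm1 permM a'_equiv sF sF' FK F'K FE); split.
  by have := N_gt1 TTQ T_gt0; case: #|_| => // -[].
exact: stage_fixed.
Qed.

(** * Lowering the isotropy *)

Section Drop.
Variables (R : realType) (X : space R) (H : finGroupType) (act : smooth_act X H).
Variables (p k : nat).
Hypotheses (p_pr : prime p) (pH : (p.-group [set: H])%g).

Lemma stab_pfactor (Y : space R) (act' : smooth_act Y H) y :
  exists n, #|stab act' y| = (p ^ n)%N.
Proof.
have : (p.-group (stabG act' y))%g.
  by apply: (pgroupS _ pH); apply/fintype.subsetP => h; rewrite !inE.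
by case/p_natP => n nE; exists n.
Qed.

Hypothesis kH : (p ^ k.+1 %| #|H|)%N.
Hypothesis stab_le : forall x, (#|stab act x| <= p ^ k.+1)%N.

Local Notation kappa := (p ^ k.+1)%N.
Local Notation o := (#|H| %/ kappa)%N.

Lemma drop_stage : exists d (act' : smooth_act (add_sphere X d) H),
  (0 < d)%N /\ forall y, (#|stab act' y| <= p ^ k)%N.
Proof.
have card_H : #|H| = (o * kappa)%N by rewrite divnK.
have p_gt1 := prime_gt1 p_pr.
have H_gt0 : (0 < #|H|)%N by apply/card_gt0P; exists 1%g.
have o_gt0 : (0 < o)%N by rewrite divn_gt0 ?expn_gt0 ?prime_gt0 // dvdn_leq.
(* Isotropy orders are powers of p, so one below [kappa] is at most [kappa] / p, hence at most
   [kappa] / 2. *)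
have slack x : #|stab act x| = kappa \/ ((o + o) * #|stab act x| <= #|H|)%N.
  have [n nE] := stab_pfactor act x; have := stab_le x; rewrite nE leq_exp2l //.
  rewrite leq_eqVlt => /orP[/eqP ->|nk]; [by left|right].
  rewrite [leqRHS]card_H addnn -muln2 -mulnA leq_pmul2l // expnS.
  by apply: leq_mul => //; rewrite leq_exp2l.
have [C [f [C_gt0 sf vf]]] := frame_all card_H slack.
pose a := stack act f.
pose a' x e r := graminv (stack act f x) e r / gramdet (stack act f x).
pose perm (h : H) (r : C * H) := (r.1, (h * r.2)%g).
have perm_inj h : injective (perm h) by move=> [m g] [m' g'] [-> /mulgI ->].
have stk_perm x h r e : stack act f (act x h) r e = stack act f x (perm h r) e.
  by rewrite /stack sactM.
have gd0 x : gramdet (stack act f x) != 0 by apply: lt0r_neq0; apply/gramdet_gt0/vf.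
have sa r e : smooth_fun (fun x => a x r e) by exact: smooth_fun_stack.
have sa' e r : smooth_fun (fun x => a' x e r).
  apply: smooth_fun_div => //; first by apply: smooth_fun_graminv; exact: smooth_fun_stack.
  by apply: smooth_fun_gramdet; exact: smooth_fun_stack.
have a'aK x y : mxapp (a' x) (mxapp (a x) y) = y.
  apply/funext => e.
  transitivity (\sum_e' (\sum_r a' x e r * a x r e') * y e').
    under [RHS]eq_bigr => e' _ do rewrite big_distrl /=.
    rewrite [RHS]exchange_big; apply: eq_bigr => r _ /=.
    by rewrite big_distrr; apply: eq_bigr => e' _; rewrite /= mulrA.
  have E e' : \sum_r a' x e r * a x r e' = (e == e')%:R.
    rewrite -[RHS](mulKf (gd0 x)) -graminv_mul big_distrr; apply: eq_bigr => r _ /=.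
    by rewrite mulrAC mulrC.
  under eq_bigr => e' _ do rewrite E.
  rewrite (bigD1 e) //= eqxx mul1r big1 ?addr0 // => e' ee'.
  by rewrite eq_sym (negPf ee') mul0r.
have card2 : (#|{: C * 'I_o}| + #|{: C * 'I_o}| <= #|{: C * H}|)%N.
  rewrite !card_prod card_ord addnn -muln2 -mulnA leq_pmul2l // [leqRHS]card_H leq_pmul2l //.
  by apply: leq_trans (leq_pexp2l _ (ltn0Sn k)); rewrite ?expn1 // ltnW.
have T_gt0 : (0 < #|{: C * 'I_o}|)%N by rewrite card_prod card_ord muln_gt0 C_gt0.
have a'_equiv x h u : mxapp (a' x) u = (fun=> 0) -> mxapp (a' (act x h)) (u \o perm h) = (fun=> 0).
  move=> u0; apply/funext => e; have := congr1 (fun f => f e) u0.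
  rewrite /mxapp (reindex_inj (perm_inj h)) /= => E; rewrite -[RHS]E; apply: eq_bigr => r _.
  congr (_ * _); rewrite /a' (graminv_reindex (perm_inj h) (stk_perm x h)).
  by rewrite (gramdet_reindex (perm_inj h) (stk_perm x h)).
have perm1 r : perm 1%g r = r by case: r => m g; rewrite /perm mul1g.
have permM g h r : perm (g * h)%g r = perm g (perm h r) by rewrite /perm mulgA.
have [d [act' [d_gt0 fixE]]] := sphere_stage sa sa' a'aK card2 T_gt0 perm1 permM a'_equiv.
(* If the isotropy did not drop at y, it would be the whole isotropy group of [y.2], of order
   [kappa]. The vector [u] would then be an orbit function, hence in the image of a; but a' kills it
   and so [u] = 0. *)
exists d, act'; split=> // y; rewrite leqNgt; apply/negP => stab_gt.
have [u [[r ur] u0 fu]] := fixE y.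
have sub : stab act' y \subset stab act y.2.
  by apply/fintype.subsetP => h /stabP/fu[xh _]; apply/stabP.
have stab_eq : #|stab act y.2| = kappa.
  apply/eqP; rewrite eqn_leq stab_le; apply: leq_trans (subset_leq_card sub).
  by have [n nE] := stab_pfactor act' y; move: stab_gt; rewrite nE ltn_exp2l // leq_exp2l.
have {}sub : stab act' y = stab act y.2.
  apply/eqP; rewrite finset.eqEcard sub stab_eq.
  by have [n nE] := stab_pfactor act' y; move: stab_gt; rewrite nE ltn_exp2l // leq_exp2l.
have ou : orbit_fun act y.2 (fun g m => u (m, g)).
  move=> g g' gg' m; have : (g * g'^-1)%g \in stab act' y by rewrite sub; exact: sact_eq.
  by move=> /stabP/fu[_ /(_ (m, g'))]; rewrite /perm mulgKV.
have cardD : (#|{: C * 'I_o}| * #|stab act y.2| = #|C| * #|H|)%N.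
  by rewrite stab_eq card_prod card_ord -mulnA -card_H.
have := stack_invKV f cardD ou r.2 r.1; rewrite big1 => [/esym/eqP|e _].
  by rewrite mulf_eq0 -surjective_pairing (negPf ur) orbF (negPf (gd0 _)).
rewrite exchange_big pair_bigA /= [X in _ * X](_ : _ = 0) ?mulr0 //.
have := congr1 (fun f => f e) u0; rewrite /mxapp => /(congr1 ( *%R (gramdet (stack act f y.2)))).
rewrite mulr0 => E; rewrite -[RHS]E big_distrr; apply: eq_bigr => -[m g] _ /=.
by rewrite stack_inv_act /a' mulrA mulrCA divff ?mulr1.
Qed.

End Drop.

Definition point (R : realType) : space R.
Proof. by refine (@Space R unit void (fun i => match i with end) _) => -[] []. Defined.

Definition point_act (R : realType) (H : finGroupType) : smooth_act (point R) H.
Proof. by refine (@SmoothAct R (point R) H (fun x _ => x) _ _ _) => // h []. Defined.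

Section Initial.
Variables (R : realType) (H : finGroupType) (Z : {group H}).
Hypotheses (nZ : normal Z [set: H]) (Z_gt1 : (1 < #|Z|)%N).

(** Over a point, a includes the functions constant on the cosets of Z and a' averages over cosets;
    the kernel of a' consists of the functions with zero coset sums. *)
Lemma init_stage : exists d (act' : smooth_act (add_sphere (point R) d) H),
  (0 < d)%N /\ forall y, ~~ (Z \subset stab act' y).
Proof.
pose T : finType := {A : {set H} | A \in rcosets Z [set: H]}.
pose a (_ : pt (point R)) (g : H) (A : T) : R := (g \in val A)%:R.
pose a' (_ : pt (point R)) (A : T) (g : H) : R := (g \in val A)%:R / #|Z|%:R.
pose perm (h g : H) := (h * g)%g.
have cosT g : (Z :* g)%g \in rcosets Z [set: H] by apply/rcosetsP; exists g; rewrite ?inE.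
pose cos g : T := exist _ (Z :* g)%g (cosT g).
have cosP (A : T) g : g \in val A -> A = cos g.
  case: A => A AT /= gA; apply/val_inj => /=; case/rcosetsP: AT gA => h _ ->.
  by move=> /rcoset_eqP ->.
have sumT (f : T -> R) g : \sum_(A : T) (g \in val A)%:R * f A = f (cos g).
  rewrite (bigD1 (cos g)) //= rcoset_refl mul1r big1 ?addr0 // => A Ag.
  by case: (boolP (g \in val A)) => [/cosP E|_]; rewrite ?mul0r // -E eqxx in Ag *.
have Z0 : (#|Z|%:R : R) != 0 by rewrite pnatr_eq0 -lt0n cardG_gt0.
have sumA (A : T) (f : H -> R) : \sum_g a' tt A g * f g = (\sum_(g in val A) f g) / #|Z|%:R.
  rewrite [in RHS]big_mkcond big_distrl; apply: eq_bigr => g _ /=.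
  by rewrite /a' mulrAC; case: ifP => _; rewrite ?mul1r // !mul0r.
have a'aK x y : mxapp (a' x) (mxapp (a x) y) = y.
  apply/funext => A; rewrite /mxapp; case: x; rewrite sumA.
  rewrite (eq_bigr (fun=> y A)) => [|g gA]; last by rewrite sumT -(cosP _ _ gA).
  rewrite sumr_const -[y A *+ _]mulr_natr -mulrA.
  have -> : #|val A| = #|Z|.
    by case: A => A /= /rcosetsP[h _ ->]; rewrite card_rcoset.
  by rewrite divff ?mulr1.
have ZT : (#|Z| * #|T| = #|H|)%N.
  by rewrite card_sig -[RHS]cardsT -(Lagrange (normal_sub nZ)).
have T_gt0 : (0 < #|T|)%N by apply/card_gt0P; exists (cos 1%g).
have TTQ : (#|T| + #|T| <= #|H|)%N by rewrite -ZT addnn -mul2n leq_mul2r Z_gt1 orbT.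
have sumcos (u : H -> R) h : mxapp (a' tt) u = (fun=> 0) -> \sum_(g in (Z :* h)%g) u g = 0.
  move=> u0; have := congr1 (fun f => f (cos h)) u0; rewrite /mxapp sumA /= => /eqP.
  by rewrite mulf_eq0 invr_eq0 (negPf Z0) orbF => /eqP.
have a'_equiv x h u : mxapp (a' x) u = (fun=> 0) ->
    mxapp (a' (point_act R H x h)) (u \o perm h) = (fun=> 0).
  case: x => u0; apply/funext => A; rewrite /mxapp sumA; apply/eqP; rewrite mulf_eq0; apply/orP; left.
  case: A => A /= /rcosetsP[g _ ->].
  rewrite -[X in _ == X](sumcos u (h * g)%g u0) [X in _ == X](reindex_inj (mulgI h)) /=.
  apply/eqP; apply: eq_bigl => g'; rewrite !mem_rcoset.
  rewrite (_ : (h * g' * (h * g)^-1 = (g' * g^-1) ^ h^-1)%g); last first.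
    by rewrite conjgE invgK invMg !mulgA.
  by rewrite memJ_norm // (fintype.subsetP (normal_norm nZ)) ?inE.
have sa r i : smooth_fun (fun x => a x r i) by exact: smooth_fun_cst.
have sa' i r : smooth_fun (fun x => a' x i r) by exact: smooth_fun_cst.
have [d [act' [d_gt0 fixE]]] := sphere_stage sa sa' a'aK TTQ T_gt0 (@mul1g H)
  (fun g h r => esym (mulgA g h r)) a'_equiv.
exists d, act'; split=> // y; apply/negP => /fintype.subsetP Zy.
(* If Z fixes y, then [u] is constant on the coset Z g. Its sum there is zero, so [u g] = 0. *)
have [u [[g ug] u0 fu]] := fixE y; case/eqP: ug.
have := sumcos u g; move: u0; case: (y.2) => u0 /(_ u0).
rewrite (eq_bigr (fun=> u g)) => [|g' /rcosetP[z zZ ->]]; last first.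
  by have [_ ->] := fu z (stabP _ _ _ (Zy z zZ)).
rewrite sumr_const card_rcoset => /eqP; rewrite mulrn_eq0 => /orP[|/eqP //].
by rewrite -leqn0 leqNgt cardG_gt0.
Qed.

End Initial.

Section Tower.
Variables (R : realType) (H : finGroupType) (p : nat).
Hypotheses (p_pr : prime p) (pH : (p.-group [set: H])%g).

Fixpoint spheres (s : seq nat) : space R :=
  if s is d :: s' then add_sphere (spheres s') d else point R.

Lemma tower k s (act : smooth_act (spheres s) H) :
  all (leq 1) s -> (p ^ k %| #|H|)%N -> (forall x, (#|stab act x| <= p ^ k)%N) ->
  exists s' (act' : smooth_act (spheres s') H),
    [/\ size s' = (size s + k)%N, all (leq 1) s' & forall x, (#|stab act' x| <= 1)%N].
Proof.
elim: k s act => [|k IH] s act s1 kH le_k.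
  by exists s, act; rewrite addn0; split=> // x; have := le_k x; rewrite expn0.
have [d [act' [d_gt0 le_k']]] := drop_stage p_pr pH kH le_k.
have [||s' [act'' [sz s'1 free]]] := IH (d :: s) act' _ _ le_k'.
- by rewrite /= d_gt0.
- by apply: dvdn_trans kH; rewrite dvdn_exp2l.
by exists s', act''; split=> //; rewrite sz addnS.
Qed.

End Tower.

(** * Isotropy bounds from the rank *)

Section Extraspecial.
Variables (gT : finGroupType) (G : {group gT}) (p : nat).
Hypotheses (p_pr : prime p) (pG : (p.-group G)%g).
Hypotheses (Phi_der : 'Phi(G)%g = G^`(1)%g) (card_der : #|G^`(1)%g| = p).

(** Commutators and p-th powers of K lie in G' = Phi(G), which meets K trivially, so K is elementary
    abelian. G' is normal of prime order in a nilpotent group, hence central, and K x G' is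
    elementary abelian of order p |K|. *)
Lemma rank_isotropy (K : {group gT}) : K \subset G -> (K :&: G^`(1) = 1)%g ->
  (#|K| <= p ^ ('r(G)%g).-1)%N /\ (0 < 'r(G)%g)%N.
Proof.
move=> KG KZ.
have nZ : normal G^`(1)%g G by exact: der_normal.
have abK : abelian K.
  by apply/derG1P/trivgP; rewrite -KZ finset.subsetI der_sub dergS.
have eK : (p.-abelem K)%g.
  apply/abelemP => //; split=> // x xK; apply/set1gP; rewrite -KZ inE groupX //=.
  rewrite -Phi_der (Phi_joing pG) mem_gen // inE; apply/orP; right.
  rewrite -[X in (x ^+ X)%g](expn1 p); apply: Mho_p_elt; first exact: (fintype.subsetP KG).
  by apply: (mem_p_elt pG); exact: (fintype.subsetP KG).
have cZ : (G^`(1)%g \subset 'Z(G))%g.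
  have : prime #|G^`(1)%g| by rewrite card_der.
  move=> /prime_meetG; apply; apply: meet_center_nil nZ _; first exact: pgroup_nil pG.
  by rewrite -cardG_gt1 card_der prime_gt1.
have eZ : (p.-abelem G^`(1)%g)%g.
  by apply: prime_abelem => //; rewrite card_der.
have KxZ : (K \x G^`(1)%g = joing K G^`(1)%g)%g.
  by rewrite dprodEY // centsC (fintype.subset_trans KG) // centsC (fintype.subset_trans cZ) // subsetIr.
have KZ_elem : joing_group K (derived_at_group G 1) \in pElem p G.
  by rewrite inE join_subG KG der_sub (dprod_abelem _ KxZ) eK eZ.
have := logn_le_p_rank KZ_elem; rewrite -(rank_pgroup pG) /=.
have cardKZ : (#|joing K G^`(1)%g| = #|K| * p)%N by rewrite -(dprod_card KxZ) card_der.
have /p_natP[n nE] : (p.-group K)%g by exact: pgroupS pG.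
rewrite cardKZ nE -expnSr pfactorK // => nr.
have r_gt0 : (0 < 'r(G)%g)%N by exact: leq_trans nr.
by split=> //; rewrite leq_exp2l ?prime_gt1 // -ltnS prednK.
Qed.

End Extraspecial.

(** A stage needs the bound on the isotropy orders to divide the group order even if no isotropy
    group attains it. *)
Lemma rank_dvdn (gT : finGroupType) (G : {group gT}) (p : nat) :
  prime p -> (p.-group G)%g -> (p ^ 'r(G)%g %| #|G|)%N.
Proof.
move=> p_pr pG; rewrite (rank_pgroup pG); have [E /pnElemP[EG _ <-]] := p_rank_witness p G.
have /p_natP[n nE] : (p.-group E)%g by exact: pgroupS pG.
by rewrite nE pfactorK // -nE cardSg.
Qed.

(** * Smoothness in Euclidean space *)

Section Flat.
Variable R : realType.

(** With s = 1/t, this is exp(s) >= (s / (k+1))^(k+1), from exp(u) >= 1 + u at u = s / (k+1). *)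
Lemma flat_le (k : nat) (t : R) : 0 < t ->
  flat k t <= (k.+1 ^ k.+1)%:R * t.
Proof.
move=> t0; rewrite /flat t0 expRN.
have tV : 0 < t^-1 by rewrite invr_gt0.
have n0 : (0 : R) < k.+1%:R by rewrite ltr0n.
have le : (t^-1 / k.+1%:R) ^+ k.+1 <= expR (t^-1).
  rewrite -[in leRHS](divfK (lt0r_neq0 n0) t^-1) expRM_natr lerXn2r ?nnegrE ?expR_ge0 //.
    by rewrite divr_ge0 ?ltW.
  by apply: le_trans (expR_ge1Dx _); rewrite ler_wpDl.
rewrite ler_pdivrMr ?expR_gt0 //; apply: le_trans (_ : _ <= _ * (t^-1 / k.+1%:R) ^+ k.+1) _; last first.
  by apply: ler_wpM2l le; rewrite mulr_ge0 ?ltW ?ltr0n ?expn_gt0.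
rewrite natrX exprMn [t^-1 ^+ k.+1]exprS [k.+1%:R^-1 ^+ k.+1]exprVn.
have b0 : (k.+1%:R : R) ^+ k.+1 != 0 by rewrite expf_neq0 ?lt0r_neq0.
move: (t^-1 ^+ k) (_ ^+ k.+1) b0 => c b b0.
rewrite le_eqVlt (_ : b * t * (t^-1 * c / b) = c) ?eqxx //.
by field; rewrite b0 lt0r_neq0.
Qed.

Lemma flat_ge0 k (t : R) : 0 <= flat k t.
Proof.
rewrite /flat; case: ifP => // t0.
by rewrite mulr_ge0 ?expR_ge0 // exprn_ge0 // invr_ge0 ltW.
Qed.

Lemma flatS k (t : R) : flat k t = flat k.+1 t * t.
Proof.
rewrite /flat; case: ifP => t0; last by rewrite mul0r.
by rewrite exprSr mulrAC mulfVK // lt0r_neq0.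
Qed.

Lemma is_derive_flat k (t : R) :
  is_derive t 1 (flat k) (flat k.+2 t - k%:R * flat k.+1 t).
Proof.
have [t0|t0|->] := ltgtP t 0.
- rewrite !flat_le0 ?ltW // mulr0 subr0.
  apply: (@near_eq_is_derive _ _ _ (cst 0)).
  near=> u; rewrite flat_le0 // ltW //; near: u; exact: lt_nbhsl.
- apply: (@near_eq_is_derive R R^o R^o (fun u : R => u^-1 ^+ k * expR (- u^-1))).
    by near=> u; rewrite /flat ifT //; near: u; exact: lt_nbhsr.
  have tn0 : t != 0 by exact: lt0r_neq0.
  have dV : is_derive t 1 (fun u : R => u^-1) (- t ^- 2 *: 1) by exact: is_deriveV.
  have dX : is_derive t 1 (fun u : R => u^-1 ^+ k) (- (k%:R * t^-1 ^+ k.+1)).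
    case: k => [|n].
      rewrite mul0r oppr0 (_ : (fun u => _) = cst 1); first exact: is_derive_cst.
      by apply/funext => u; rewrite expr0.
    rewrite (_ : (fun u => _) = (fun u : R => u^-1) ^+ n.+1); last first.
      by apply/funext => u; rewrite exprfctE.
    apply: is_derive_eq; rewrite /GRing.scale /= mulr1 -exprVn [_ ^+ n.+2]exprS [_ ^+ n.+1]exprS.
    by rewrite expr2; ring.
  have dE : is_derive t 1 (fun u : R => expR (- u^-1)) (expR (- t^-1) * t^-1 ^+ 2).
    have dN : is_derive t 1 (fun u : R => - u^-1) (t^-1 ^+ 2).
      by apply: is_derive_eq; rewrite /GRing.scale /= mulr1 opprK exprVn.
    exact: (@is_derive1_comp _ expR (fun u : R => - u^-1)).
  rewrite /flat t0.
  apply: (is_derive_eq (is_deriveM dX dE)).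
  rewrite /GRing.scale /= !exprS; ring.
(* At 0 the difference quotient of [flat k] is [flat k.+1] itself, which tends to 0 by the linear
   bound. *)
- apply/is_derive1_caratheodory; exists (flat k.+1); split.
  + by move=> z; rewrite [flat k z]flatS [flat k 0]flatS mulr0 !subr0.
  + apply/(@cvgrPdist_lt R R^o) => /= e e0.
    have [K K0 KP] : exists2 K : R, 0 < K & (forall u, flat k.+1 u <= K * `|u|).
      exists ((k.+2 ^ k.+2)%:R) => [|u]; first by rewrite ltr0n expn_gt0.
      have [u0|u0] := lerP u 0; first by rewrite flat_le0 // mulr_ge0.
      by rewrite gtr0_norm // flat_le.
    rewrite flat_le0 //; near=> u; rewrite sub0r normrN ger0_norm ?flat_ge0 //.
    apply: le_lt_trans (KP u) _; rewrite -ltr_pdivlMl //.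
    rewrite -[u]subr0 distrC; near: u; apply: cvgr_dist_lt => //.
    by rewrite mulrC divr_gt0.
  + by rewrite !flat_le0 // mulr0 subr0.
Unshelve. all: by end_near. Qed.

Lemma continuous_flat k : continuous (flat k : R -> R).
Proof.
move=> t; apply/differentiable_continuous/derivable1_diffP.
by have := is_derive_flat k t => -[].
Qed.

End Flat.

Section Elementary.
Local Open Scope classical_set_scope.
Local Open Scope ring_scope.
Variables (R : realType) (m : nat).
Local Notation V := 'rV[R]_m.

(** The local counterpart of [smooth_fun], closed under partial derivatives. *)
Inductive elementary (U : set V) : (V -> R) -> Prop :=
| elementary_cst c : elementary U (fun=> c)
| elementary_crd j : elementary U (fun x => x 0 j)
| elementary_add f g : elementary U f -> elementary U g -> elementary U (fun x => f x + g x)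
| elementary_mul f g : elementary U f -> elementary U g -> elementary U (fun x => f x * g x)
| elementary_inv f : elementary U f -> (forall x, U x -> f x != 0) -> elementary U (fun x => (f x)^-1)
| elementary_sqrt f : elementary U f -> (forall x, U x -> 0 < f x) -> elementary U (fun x => Num.sqrt (f x))
| elementary_flat k f : elementary U f -> elementary U (fun x => flat k (f x)).

Lemma elementary_sub (U U' : set V) f : (U' `<=` U)%classic -> elementary U f -> elementary U' f.
Proof.
move=> UU'; elim=> {f}.
- by move=> c; exact: elementary_cst.
- by move=> j; exact: elementary_crd.
- by move=> f g _ ? _ ?; exact: elementary_add.
- by move=> f g _ ? _ ?; exact: elementary_mul.
- by move=> f _ ? f0; apply: elementary_inv => // x /UU'; exact: f0.
- by move=> f _ ? f0; apply: elementary_sqrt => // x /UU'; exact: f0.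
- by move=> k f _ ?; exact: elementary_flat.
Qed.

Lemma is_derive_line (f : V -> R) x v df :
  is_derive x v f df <-> is_derive (0 : R) 1 (fun t : R => f (t *: v + x)) df.
Proof.
have E : (fun h : R => h^-1 *: ((f \o shift x) (h *: v) - f x)) =
    (fun h : R => h^-1 *: (((fun t : R => f (t *: v + x)) \o shift 0) (h *: 1)
                           - (fun t : R => f (t *: v + x)) 0)).
  by apply/funext => h /=; rewrite addr0 [_%:A]mulr1 scale0r add0r.
split=> -[d1 d2]; split.
- by rewrite /derivable -E.
- by rewrite -d2 /derive -E.
- by rewrite /derivable E.
- by rewrite -d2 /derive E.
Qed.

Lemma is_derive_chain (h : R -> R) (f : V -> R) x v df dh :
  is_derive x v f df -> is_derive (f x) 1 h dh -> is_derive x v (h \o f) (dh * df).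
Proof.
move=> /is_derive_line df0 dh0; apply/is_derive_line.
apply: (@is_derive1_comp _ h (fun t : R => f (t *: v + x))) => //.
by rewrite scale0r add0r.
Qed.

Lemma elementary_derive U f (i : 'I_m) : elementary U f ->
  exists2 f', elementary U f' & forall x, U x -> is_derive x (delta_mx 0 i) f (f' x).
Proof.
elim=> {f}.
- by move=> c; exists (fun=> 0); [exact: elementary_cst|move=> x _; exact: is_derive_cst].
- move=> j; exists (fun=> (j == i)%:R); [exact: elementary_cst|move=> x _].
  apply/is_derive_line.
  have -> : (fun t : R => (t *: delta_mx 0 i + x) 0 j) = (fun t => (j == i)%:R * t + x 0 j) :> (R -> R).
    by apply/funext => t; rewrite !mxE eqxx /= mulrC.
  apply: is_derive_eq.
  by rewrite /GRing.scale /=; ring.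
- move=> f g ef [f' ef' df] eg [g' eg' dg].
  exists (fun x => f' x + g' x); first exact: elementary_add.
  by move=> x Ux; apply: is_deriveD; [exact: df|exact: dg].
- move=> f g ef [f' ef' df] eg [g' eg' dg].
  exists (fun x => f x * g' x + g x * f' x).
    by apply: elementary_add; exact: elementary_mul.
  by move=> x Ux; apply: is_deriveM; [exact: df|exact: dg].
- move=> f ef [f' ef' df] f0.
  exists (fun x => (-1) * ((f x)^-1 * (f x)^-1) * f' x).
    apply: elementary_mul => //; apply: elementary_mul; first exact: elementary_cst.
    by apply: elementary_mul; exact: elementary_inv.
  move=> x Ux; apply: (@is_derive_chain (fun u : R => u^-1)); first exact: df.
  have fx0 := f0 _ Ux.
  have := @is_deriveV _ id (f x) 1 1 fx0 (is_derive_id _ _).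
  move=> D; apply: (is_derive_eq D).
  by rewrite /GRing.scale /= mulr1 mulN1r -exprVn expr2.
- move=> f ef [f' ef' df] f0.
  exists (fun x => (2 * Num.sqrt (f x))^-1 * f' x).
    apply: elementary_mul => //; apply: elementary_inv => [|x Ux].
      by apply: elementary_mul; [exact: elementary_cst|exact: elementary_sqrt].
    by rewrite mulf_neq0 ?pnatr_eq0 // lt0r_neq0 // sqrtr_gt0 f0.
  move=> x Ux; apply: (@is_derive_chain Num.sqrt); first exact: df.
  by apply: is_derive1_sqrt; exact: f0.
- move=> k f ef [f' ef' df].
  exists (fun x => (flat k.+2 (f x) + (-1) * (k%:R * flat k.+1 (f x))) * f' x).
    apply: elementary_mul => //; apply: elementary_add; first exact: elementary_flat.
    apply: elementary_mul; first exact: elementary_cst.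
    by apply: elementary_mul; [exact: elementary_cst|exact: elementary_flat].
  move=> x Ux; apply: (@is_derive_chain (flat k)); first exact: df.
  by rewrite mulN1r; exact: is_derive_flat.
Qed.

Lemma elementary_continuous U f : elementary U f -> forall x, U x -> {for x, continuous f}.
Proof.
elim=> {f}.
- by move=> c x _; exact: cst_continuous.
- by move=> j x _; exact: coord_continuous.
- by move=> f g _ cf _ cg x Ux; exact: (cvgD (cf x Ux) (cg x Ux)).
- by move=> f g _ cf _ cg x Ux; exact: (cvgM (cf x Ux) (cg x Ux)).
- by move=> f _ cf f0 x Ux; exact: (cvgV (f0 x Ux) (cf x Ux)).
- move=> f _ cf f0 x Ux.
  by apply: (@continuous_comp _ _ _ f Num.sqrt); [exact: cf|exact: sqrt_continuous].
- move=> k f _ cf x Ux.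
  by apply: (@continuous_comp _ _ _ f (flat k)); [exact: cf|exact: continuous_flat].
Qed.

Lemma continuous_row n (F : 'I_n -> V -> R) x :
  (forall j, {for x, continuous (F j)}) ->
  {for x, continuous (fun y => \row_j F j y)}.
Proof.
move=> cF; have FF : Filter (nbhs x) by exact: nbhs_filter.
apply: (proj2 (@cvgrPdist_le R 'rV[R]_n V (nbhs x) _ (fun y => \row_j F j y) (\row_j F j x))).
move=> e e0; have cFe j := proj1 (@cvgrPdist_le R R V (nbhs x) _ (F j) (F j x)) (cF j) e e0.
apply: (@filterS _ (nbhs x) FF _ _ _ (filter_forall FF (cFe FF))) => y Fy.
rewrite /Num.Def.normr/= mx_normrE (bigmax_le _ (ltW e0))//= => i _.
by rewrite !mxE; exact: Fy.
Qed.

(** Iterated partials agree with elementary functions on [U] only; openness makes this agreement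
    local, so it survives differentiation. *)
Lemma elementary_smooth_on (U : set V) n (F : 'I_n -> V -> R) : open U ->
  (forall j, elementary U (F j)) -> smooth_on U (fun x => \row_j F j x).
Proof.
move=> oU eF s.
have [G eG GE] : exists2 G : 'I_n -> V -> R, (forall j, elementary U (G j)) &
    forall x, U x -> iter_partial s (fun x => \row_j F j x) x = \row_j G j x.
  elim: s => [|i s [G eG GE]]; first by exists F.
  have [G' G'P] := choice (fun j => (fun P => let: ex_intro2 a b c := P in
     ex_intro (fun f' => elementary U f' /\ forall x, U x -> is_derive x (delta_mx 0 i) (G j) (f' x)) a (conj b c))
     (elementary_derive i (eG j))).
  exists G' => [j|x Ux]; first exact: (G'P j).1.
  rewrite /iter_partial /= -/(iter_partial s _).
  rewrite (@near_eq_derive _ _ _ _ (fun y => \row_j G j y)); last first.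
    by apply: filterS (open_nbhs_nbhs (conj oU Ux)) => y; exact: GE.
  rewrite derive_mx; last first.
    apply/derivable_mxP => k j.
    rewrite (_ : (fun y => _) = G j); last by apply/funext => y; rewrite mxE.
    by have [] := (G'P j).2 x Ux.
  apply/matrixP => k j; rewrite !mxE.
  rewrite (_ : (fun y => _) = G j); last by apply/funext => y; rewrite mxE.
  by have [_ ->] := (G'P j).2 x Ux.
move=> x Ux.
have nE : \forall y \near x, iter_partial s (fun x => \row_j F j x) y = \row_j G j y.
  by apply: filterS (open_nbhs_nbhs (conj oU Ux)) => y; exact: GE.
split.
  have cG : {for x, continuous (fun y => \row_j G j y)}.
    by apply: continuous_row => j; exact: elementary_continuous (eG j) _ Ux.
  rewrite /prop_for /continuous_at (GE _ Ux); apply: cvg_trans cG.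
  apply: (@near_eq_cvg _ _ (nbhs x) (nbhs_filter x)).
  by apply: (@filterS _ (nbhs x) (nbhs_filter x) _ _ _ nE) => y ->.
move=> i; apply: (near_eq_derivable (f := fun y => \row_j G j y)).
  by apply: (@filterS _ (nbhs x) (nbhs_filter x) _ _ _ nE) => y ->.
apply/derivable_mxP => k j.
rewrite (_ : (fun y => _) = G j); last by apply/funext => y; rewrite mxE.
by have [f' _ /(_ x Ux) []] := elementary_derive i (eG j).
Qed.

End Elementary.

Section SetSpace.
Local Open Scope classical_set_scope.
Local Open Scope ring_scope.
Variables (R : realType) (m : nat) (A : set 'rV[R]_m).

Lemma set_crd_inj (x y : A) : (forall j, set_val x 0 j = set_val y 0 j) -> x = y.
Proof. by move=> E; apply/val_inj/matrixP => i j; rewrite ord1; exact: E. Qed.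

Definition set_space : space R := @Space R A _ (fun j (x : A) => set_val x 0 j) set_crd_inj.

(** The conditions on inverses and square roots are known only on A. By continuity of the extension
    they persist near x, so [U] is shrunk at each such operation. *)
Lemma smooth_fun_extends (f : pt set_space -> R) : smooth_fun f -> forall x : A,
  exists (U : set 'rV[R]_m) (F : 'rV[R]_m -> R),
    [/\ open U, U (set_val x), elementary U F & forall y : A, U (set_val y) -> f y = F (set_val y)].
Proof.
have shrink (U : set 'rV[R]_m) (F : 'rV[R]_m -> R) (D : set R) (x : A) :
    open U -> U (set_val x) -> elementary U F -> nbhs (F (set_val x)) D ->
    exists U', [/\ open U', U' (set_val x), (U' `<=` U) & forall y, U' y -> D (F y)].
  move=> oU Ux eF nD; exists (U `&` interior (F @^-1` D)); split.
  - by apply: openI => //; exact: open_interior.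
  - by split=> //; exact: (elementary_continuous eF Ux nD).
  - by move=> y [].
  - by move=> y [_ /interior_subset].
elim=> {f} [c|j|f g _ IHf _ IHg|f g _ IHf _ IHg|f _ IHf f0|f _ IHf f0|f _ IHf] x.
- by exists setT, (fun=> c); split=> //; [exact: openT|exact: elementary_cst].
- by exists setT, (fun x => x 0 j); split=> //; [exact: openT|exact: elementary_crd].
- have [U [F [oU Ux eF EF]]] := IHf x; have [W [G [oW Wx eG EG]]] := IHg x.
  exists (U `&` W), (fun x => F x + G x); split=> //; first exact: openI.
  + by apply: elementary_add; [apply: elementary_sub eF|apply: elementary_sub eG] => y [].
  + by move=> y [Uy Wy]; rewrite EF // EG.
- have [U [F [oU Ux eF EF]]] := IHf x; have [W [G [oW Wx eG EG]]] := IHg x.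
  exists (U `&` W), (fun x => F x * G x); split=> //; first exact: openI.
  + by apply: elementary_mul; [apply: elementary_sub eF|apply: elementary_sub eG] => y [].
  + by move=> y [Uy Wy]; rewrite EF // EG.
- have [U [F [oU Ux eF EF]]] := IHf x.
  have nD : nbhs (F (set_val x)) [set r | r != 0].
    by apply: open_nbhs_nbhs; split; [exact: open_neq|rewrite /= -EF].
  have [U' [oU' U'x sub FU']] := shrink _ _ _ _ oU Ux eF nD.
  exists U', (fun x => (F x)^-1); split=> //.
  + by apply: elementary_inv => //; exact: elementary_sub eF.
  + by move=> y /sub Uy; rewrite EF.
- have [U [F [oU Ux eF EF]]] := IHf x.
  have nD : nbhs (F (set_val x)) [set r | 0 < r].
    by apply: open_nbhs_nbhs; split; [exact: open_gt|rewrite /= -EF].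
  have [U' [oU' U'x sub FU']] := shrink _ _ _ _ oU Ux eF nD.
  exists U', (fun x => Num.sqrt (F x)); split=> //.
  + by apply: elementary_sqrt => //; exact: elementary_sub eF.
  + by move=> y /sub Uy; rewrite EF.
- have [U [F [oU Ux eF EF]]] := IHf x.
  exists U, (fun x => flat 0 (F x)); split=> //; first exact: elementary_flat.
  by move=> y Uy; rewrite EF.
Qed.

Lemma smooth_fun_smooth_map n (B : set 'rV[R]_n) (f : A -> B) :
  (forall j, @smooth_fun R set_space (fun x => set_val (f x) 0 j)) -> smooth_map f.
Proof.
move=> sf x.
pose UF j (P : set 'rV[R]_m * ('rV[R]_m -> R)) := [/\ open P.1, P.1 (set_val x), elementary P.1 P.2 &
  forall y : A, P.1 (set_val y) -> set_val (f y) 0 j = P.2 (set_val y)].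
have [UFs UFP] : {P : 'I_n -> set 'rV[R]_m * ('rV[R]_m -> R) & forall j, UF j (P j)}.
  apply: choice => j; have [U [F H]] := smooth_fun_extends (sf j) x.
  by exists (U, F).
set U := interior [set y | forall j, (UFs j).1 y].
have UU y : U y -> forall j, (UFs j).1 y by move=> /interior_subset.
exists U, (fun y => \row_j (UFs j).2 y); split.
- exact: open_interior.
- apply: (@filter_forall _ _ _ (nbhs (set_val x)) (nbhs_filter _)) => j.
  by case: (UFP j) => oP Px _ _; apply: open_nbhs_nbhs.
- apply: elementary_smooth_on; first exact: open_interior.
  by move=> j; case: (UFP j) => _ _ eF _; apply: elementary_sub eF => y /UU; exact.
- move=> y Uy; apply/matrixP => i j; rewrite ord1 mxE.
  by case: (UFP j) => _ _ _; apply; exact: UU.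
Qed.

End SetSpace.

(** * From the tower of spheres to the product of spheres *)

Section Bridge.
Variables (R : realType).

Definition pole (d : nat) : sphere_pt R d.
Proof.
refine (exist (fun v : {ffun 'I_d.+1 -> R} => \sum_i v i ^+ 2 == 1) [ffun i => (i == ord0)%:R] _).
rewrite (bigD1 ord0) //= ffunE eqxx expr1n big1 ?addr0 // => i i0.
by rewrite ffunE (negPf i0) expr0n.
Defined.

(** Natural number indices with default 0 allow nested pairs to be compared with matrix blocks
    without transport along equal dimensions. *)
Fixpoint sphere_coord (s : seq nat) : pt (spheres R s) -> nat -> nat -> R :=
  match s return pt (spheres R s) -> nat -> nat -> R with
  | [::] => fun _ _ _ => 0
  | d :: s' => fun y i j =>
      if i is i'.+1 then sphere_coord y.2 i' j else if insub j is Some k then val y.1 k else 0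
  end.

(** [pole] is only a default for blocks that are not unit vectors. *)
Fixpoint of_coord (s : seq nat) (f : nat -> nat -> R) : pt (spheres R s) :=
  match s return pt (spheres R s) with
  | [::] => tt
  | d :: s' => (insubd (pole d) [ffun k : 'I_d.+1 => f 0%N k], of_coord s' (fun i => f i.+1))
  end.

Lemma coord_eq s (x y : pt (spheres R s)) : sphere_coord x =2 sphere_coord y -> x = y.
Proof.
elim: s x y => [[] [] //|d s IH [v x] [w y]] E; congr (_, _).
  by apply/val_inj/ffunP => k; have := E 0%N k; rewrite /= !valK.
by apply: IH => i j; exact: (E i.+1 j).
Qed.

Lemma coord_sum s (x : pt (spheres R s)) i : (i < size s)%N ->
  \sum_(j < (nth 0%N s i).+1) sphere_coord x i j ^+ 2 = 1.
Proof.
elim: s x i => [//|d s IH [v x]] [|i] /= si; last exact: IH.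
by rewrite -[RHS](eqP (valP v)); apply: eq_bigr => k _; rewrite valK.
Qed.

Lemma coord_out s (x : pt (spheres R s)) i j :
  ((size s <= i) || ((nth 0%N s i).+1 <= j))%N -> sphere_coord x i j = 0.
Proof.
elim: s x i => [//|d s IH [v x]] [|i] /=; last exact: IH.
by move=> dj; case: insubP => // k; rewrite ltnNge dj.
Qed.

Lemma of_coordK s (f : nat -> nat -> R) i j : (i < size s)%N -> (j < (nth 0%N s i).+1)%N ->
  (forall i, (i < size s)%N -> \sum_(j < (nth 0%N s i).+1) f i j ^+ 2 = 1) ->
  sphere_coord (of_coord s f) i j = f i j.
Proof.
elim: s f i => [|d s IH] f [|i] //= si js f1; last first.
  by apply: (IH (fun i => f i.+1)) => // k; exact: (f1 k.+1).
rewrite (insubT (fun j => j < d.+1)%N js) /= val_insubd.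
have -> : \sum_i ([ffun k : 'I_d.+1 => f 0%N k] : {ffun 'I_d.+1 -> R}) i ^+ 2 == 1.
  apply/eqP; rewrite -[RHS](f1 0%N) //.
  by apply: eq_bigr => k _; rewrite ffunE.
by rewrite ffunE.
Qed.

Lemma coord_inj s (x y : pt (spheres R s)) :
  (forall i j, (i < size s)%N -> (j < (nth 0%N s i).+1)%N -> sphere_coord x i j = sphere_coord y i j) -> x = y.
Proof.
move=> E; apply: coord_eq => i j; case: (ltnP i (size s)) => si.
  case: (ltnP j (nth 0%N s i).+1) => sj; first exact: E.
  by rewrite !coord_out ?sj ?orbT.
by rewrite !coord_out ?si.
Qed.

Lemma smooth_fun_coord s i j : smooth_fun (fun x : pt (spheres R s) => sphere_coord x i j).
Proof.
elim: s i => [|d s IH] i /=; first exact: smooth_fun_cst.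
case: i => [|i].
  case: (insub j) => [k|]; last exact: smooth_fun_cst.
  exact: (@smooth_fun_crd R (add_sphere (spheres R s) d) (inl k)).
apply: (@smooth_fun_comp R (add_sphere (spheres R s) d) (spheres R s) snd _ _ (IH i)) => k.
exact: (@smooth_fun_crd R (add_sphere (spheres R s) d) (inr k)).
Qed.

Lemma crd_coord s (i : idx (spheres R s)) :
  exists k l, forall x : pt (spheres R s), crd i x = sphere_coord x k l.
Proof.
elim: s i => [[]|d s IH [] i].
  by exists 0%N, i => -[v x] /=; rewrite valK.
by have [k [l E]] := IH i; exists k.+1, l => -[v x]; exact: E.
Qed.

Lemma smooth_fun_of_coord (X : space R) s (f : pt X -> nat -> nat -> R) :
  (forall i j, smooth_fun (fun x => f x i j)) ->
  (forall x i, (i < size s)%N -> \sum_(j < (nth 0%N s i).+1) f x i j ^+ 2 = 1) ->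
  forall i, smooth_fun (fun x => crd i (of_coord s (f x))).
Proof.
move=> sf f1 i; have [k [l E]] := crd_coord i.
case: (boolP ((k < size s) && (l < (nth 0%N s k).+1))%N) => [/andP[sk sl]|out].
  apply: (eq_smooth_fun (f := fun x => f x k l)) => // x.
  by rewrite E of_coordK //; exact: f1.
apply: (eq_smooth_fun (f := fun=> 0)); last exact: smooth_fun_cst.
by move=> x; rewrite E coord_out //; move: out; rewrite negb_and -!leqNgt.
Qed.

End Bridge.

Section Transport.
Variables (R : realType) (s : seq nat) (r : nat).
Hypothesis size_s : size s = r.
Variables (gT : finGroupType) (G : {group gT}).
Variable act : smooth_act (spheres R s) (subg_of G).
Hypothesis free : forall x, (#|stab act x| <= 1)%N.

Local Notation n := (fun i : 'I_r => nth 0%N s i).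
Local Notation A := (product_of_spheres R n).

Definition block_coord (x : A) (i j : nat) : R :=
  if insub i is Some i' then
    if insub j is Some j' then submxrow (set_val x) (i' : 'I_r) 0 (j' : 'I_(n i').+1) else 0
  else 0.

Lemma block_coordE (x : A) (i : 'I_r) (j : 'I_(n i).+1) :
  block_coord x i j = submxrow (set_val x) i 0 j.
Proof. by rewrite /block_coord !valK. Qed.

Lemma block_coord_sum (x : A) i : (i < size s)%N ->
  \sum_(j < (nth 0%N s i).+1) block_coord x i j ^+ 2 = 1.
Proof.
rewrite size_s => ir; have /set_mem /(_ (Ordinal ir)) := valP x; rewrite /unit_sphere /= => E.
rewrite -[RHS]E; apply: eq_bigr => j _.
by rewrite (@block_coordE x (Ordinal ir)).
Qed.

Definition to_spheres (x : A) : pt (spheres R s) := of_coord s (block_coord x).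

Definition of_spheres_mx (y : pt (spheres R s)) : 'rV[R]_(\sum_(i < r) (n i).+1) :=
  \mxrow_(i < r) \row_(j < (n i).+1) sphere_coord y i j.

Lemma of_spheres_subproof y : of_spheres_mx y \in A.
Proof.
apply/mem_set => i; rewrite /unit_sphere /of_spheres_mx /= mxrowK.
have ir : (i < size s)%N by rewrite size_s.
by rewrite -[RHS](coord_sum y ir); apply: eq_bigr => j _; rewrite mxE.
Qed.

Definition of_spheres (y : pt (spheres R s)) : A :=
  exist (fun x => x \in A) _ (of_spheres_subproof y).

Lemma to_spheresK : cancel to_spheres of_spheres.
Proof.
move=> x; apply/val_inj/mxrowP => i; rewrite /= mxrowK; apply/rowP => j; rewrite mxE.
have ir : (i < size s)%N by rewrite size_s.
by rewrite (of_coordK ir (ltn_ord j) (@block_coord_sum x)) block_coordE.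
Qed.

Lemma of_spheresK : cancel of_spheres to_spheres.
Proof.
move=> y; apply: coord_inj => i j si sj; rewrite of_coordK //; last exact: block_coord_sum.
have ir : (i < r)%N by rewrite -size_s.
by rewrite (@block_coordE _ (Ordinal ir) (Ordinal sj)) mxrowK mxE.
Qed.

(** [subg] sends elements outside G to 1, so every element acts bijectively, as [is_action]
    demands. *)
Definition transported (x : A) (a : gT) : A := of_spheres (act (to_spheres x) (subg G a)).

Lemma transported_is_action : is_action G transported.
Proof.
split=> [a x y /(can_inj of_spheresK) E|x a b aG bG].
  apply: (can_inj to_spheresK).
  by rewrite -(sactV act (to_spheres x) (subg G a)) E sactV.
by rewrite /transported of_spheresK subgM // sactM.
Qed.

Lemma transported_smooth a : smooth_map (fun x => transported x a).
Proof.
apply: smooth_fun_smooth_map => j.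
have sblock i k : @smooth_fun R (set_space A) (fun x => block_coord x i k).
  rewrite /block_coord; case: (insub i) => [i'|]; last exact: smooth_fun_cst.
  case: (insub k) => [k'|]; last exact: smooth_fun_cst.
  apply: (@eq_smooth_fun _ (set_space A) (fun x : A => set_val x 0 (tagnat.Rank i' k'))).
    by move=> x; rewrite /submxrow mxE.
  exact: smooth_fun_crd.
have sto i : @smooth_fun R (set_space A) (fun x => crd i (to_spheres x)).
  by apply: smooth_fun_of_coord => // x; exact: block_coord_sum.
pose i := tagnat.sig1 j; pose k := tagnat.sig2 j.
apply: (@eq_smooth_fun _ (set_space A) (fun x : A => sphere_coord (act (to_spheres x) (subg G a)) i k)).
  by move=> x; rewrite /transported /= /of_spheres_mx /mxrow !mxE.
have sact_to l : @smooth_fun R (set_space A) (fun x => crd l (act (to_spheres x) (subg G a))).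
  exact: (smooth_fun_comp sto (smooth_fun_sact act _ l)).
exact: (@smooth_fun_comp R (set_space A) (spheres R s) _ sact_to _ (@smooth_fun_coord R s i k)).
Qed.

Lemma transported_free x a : a \in G -> transported x a = x -> a = 1%g.
Proof.
move=> aG E; have : subg G a \in stab act (to_spheres x).
  by apply/stabP; rewrite -{2}E /transported of_spheresK.
have := free (to_spheres x) => /(@card_le1_trivg _ (stabG act _)) /= ->.
by move=> /set1gP /(congr1 sgval); rewrite subgK.
Qed.

End Transport.

Theorem corollary1p3 (R : realType) (gT : finGroupType) (G : {group gT})
    (p : nat) (p_prime : prime p) (pG : (p.-group G)%g)
    (hG : extraspecial G \/ almost_extraspecial p G) :
  exists n : 'I_('r(G)%g) -> nat,
    (forall i, (0 < n i)%N) /\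
    exists to : action G (product_of_spheres R n),
      free_action to /\ smooth_action to.
Proof.
(* Both kinds of group enter the argument only through these two equalities. *)
have [Phi_der card_der] : 'Phi(G)%g = G^`(1)%g /\ #|G^`(1)%g| = p.
  case: hG => [[[PhiZ derZ] prZ]|[-> ? _ _] //].
  split; first by rewrite PhiZ derZ.
  rewrite derZ; apply/eqP; rewrite eq_sym -dvdn_prime2 //.
  have : (p.-group 'Z(G))%g by exact: pgroupS (center_sub G) pG.
  case/p_natP => k kE; move: prZ; rewrite kE.
  by case: k {kE} => [|k _]; [rewrite expn0|exact: dvdn_exp].
have [_ r_gt0] := rank_isotropy p_prime pG Phi_der card_der (sub1G G) (setI1g _).
(* The stages act by all elements of a group type, so G is turned into one. *)
pose H : finGroupType := subg_of G.
have cardH : #|H| = #|G| by rewrite card_sub; apply: eq_card.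
have pH : (p.-group [set: H])%g by rewrite /pgroup cardsT cardH.
pose Zset := [set h : H | sgval h \in G^`(1)%g].
have Zgroup : group_set Zset.
  by apply/group_setP; split=> [|g h]; rewrite !inE ?group1 //; exact: groupM.
pose Z := Group Zgroup.
have imZ : [set sgval h | h in Z] = G^`(1)%g.
  apply/setP => z; apply/imsetP/idP => [[h]|zG']; first by rewrite inE => hZ ->.
  have zG : z \in G by apply: fintype.subsetP zG'; exact: der_sub.
  by exists (subg G z); rewrite ?inE subgK.
have cardZ : #|Z| = p by rewrite -card_der -imZ card_imset //; exact: subg_inj.
have nZ : normal Z [set: H].
  apply/andP; split; first by apply/fintype.subsetP => h; rewrite inE.
  apply/fintype.subsetP => h _; rewrite inE; apply/fintype.subsetP => _ /imsetP[z zZ ->].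
  move: zZ; rewrite !inE => zZ.
  have -> : sgval (z ^ h)%g = (sgval z ^ sgval h)%g by [].
  by rewrite memJ_norm //; apply: fintype.subsetP (subgP h); exact: der_norm.
have Z_gt1 : (1 < #|Z|)%N by rewrite cardZ prime_gt1.
have [d [act0 [d_gt0 isoZ]]] := init_stage R nZ Z_gt1.
have le_iso x : (#|stab act0 x| <= p ^ ('r(G)%g).-1)%N.
  (* Z has prime order, so a subgroup not containing it meets it trivially. *)
  have TI : (stabG act0 x :&: Z = 1)%g.
    by rewrite finset.setIC; apply: (@prime_TIg _ Z (stabG act0 x)); rewrite ?cardZ ?isoZ.
  have KG : (sgval @* stabG act0 x)%g \subset G.
    by apply/fintype.subsetP => _ /morphimP[h _ _ ->]; exact: subgP.
  have KZ : ((sgval @* stabG act0 x)%G :&: G^`(1) = 1)%g.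
    apply/trivgP/fintype.subsetP => _ /setIP[/morphimP[h _ hK ->] hZ].
    have : h \in (stabG act0 x :&: Z)%g by rewrite inE hK inE.
    by rewrite TI => /set1gP ->; rewrite inE.
  have [le _] := rank_isotropy p_prime pG Phi_der card_der KG KZ.
  apply: leq_trans le; rewrite card_injm ?injm_sgval //.
  by apply/fintype.subsetP => h; rewrite inE.
have dvd_r : (p ^ ('r(G)%g).-1 %| #|H|)%N.
  rewrite cardH; apply: dvdn_trans (rank_dvdn p_prime pG).
  by rewrite dvdn_exp2l // leq_pred.
have d1 : all (leq 1) [:: d] by rewrite /= d_gt0.
have [s [act [size_s s_gt0 free]]] := tower p_prime pH (s := [:: d]) d1 dvd_r le_iso.
have size_r : size s = 'r(G)%g by rewrite size_s add1n prednK.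
exists (fun i => nth 0%N s i); split=> [i|].
  by have /all_nthP := s_gt0; apply; rewrite size_r.
exists (Action (transported_is_action size_r act)); split.
  by move=> x a; exact: transported_free.
by move=> a aG; exact: transported_smooth.
Qed.
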